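(* Let $(\mu_k)_{k=1}^\infty$ and $(\beta_j)_{j=1}^\infty$ be divergent, strictly increasing sequences of real numbers that preserve the addition and the unit increment, with $\mu_1>0$ and $\beta_1\ge 0$. Assume there is $T_f\ge 0$ such that $f$ is continuous on $[T_f,\infty)$, and that $$f(t)\sim\sum_{k=1}^\infty\frac{1}{t^{\mu_k}}\Big(\sum_{j=1}^\infty\frac{p_{k,j}(\ln\ln t)}{\ln^{\beta_j}(t)}\Big),$$ where $p_{k,j}:\mathbb R\to\mathbb R^n$ are polynomials which, for each $k\in\mathbb N$, differ from zero for only finitely many $j$'s. Let $T_0\ge 0$ and let $y\in C^1((T_0,\infty),\mathbb R^n)$ be a solution of $y'=-Ay+G(y)+f(t)$ on $(T_0,\infty)$ with $y(t)\to 0$ as $t\to\infty$. Then $$y(t)\sim\sum_{k=1}^\infty\frac{1}{t^{\mu_k}}\Big(\sum_{j=1}^\infty\frac{q_{k,j}(\ln\ln t)}{\ln^{\beta_j}(t)}\Big),$$ where $q_{k,j}:\mathbb R\to\mathbb R^n$ are the polynomials defined by $q_{1,j}=A^{-1}p_{1,j}$ for $j\in\mathbb N$, and, for $k\ge 2$, $j\in\mathbb N$, $$q_{k,j}=A^{-1}\Big\{\sum_{m\ge 2}\ \sum_{\substack{\mu_{j_1}+\mu_{j_2}+\cdots+\mu_{j_m}=\mu_k\\ \beta_{l_1}+\beta_{l_2}+\cdots+\beta_{l_m}=\beta_j}}\mathcal G_m(q_{j_1,l_1},q_{j_2,l_2},\ldots,q_{j_m,l_m})+p_{k,j}+\chi_{k,j}\Big\},$$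 with $$\chi_{k,j}=\begin{cases}\mu_\lambda q_{\lambda,j}-q_{\lambda,\ell}'+\beta_\ell q_{\lambda,\ell},&\text{if there exist }\lambda,\ell\ge 1\text{ such that }\mu_\lambda+1=\mu_k,\ \beta_\ell+1=\beta_j,\\ 0,&\text{otherwise.}\end{cases}$$
   Context: Notation: $\mathbb N=\{1,2,\ldots\}$, $|\cdot|$ is the Euclidean norm on $\mathbb R^n$, $n\in\mathbb N$ fixed, $\ln^\beta(t)=(\ln t)^\beta$, $\ln\ln t=\ln(\ln t)$. For functions of $t$, $g(t)=\mathcal O(h(t))$ means there are $T,C>0$ with $|g(t)|\le Ch(t)$ for all $t\ge T$. For a non-negative function $F$ defined near the origin of $\mathbb R^n$ and $\alpha>0$, $F(y)=\mathcal O(|y|^\alpha)$ as $y\to0$ means there are $r,C>0$ with $F(y)\le C|y|^\alpha$ for all $|y|<r$. A set $S\subset\mathbb R$ preserves the addition if $x+y\in S$ for all $x,y\in S$; it preserves the unit increment if $x+1\in S$ for all $x\in S$; a sequence is said to have one of these properties if the set of its values has it. In the double-indexed sums all indices $j_1,\ldots,j_m,l_1,\ldots,l_m$ range over integers $\ge 1$ satisfying the indicated equalities; empty sums are zero. A prime on $q_{\lambda,\ell}$ denotes its derivative. Standing assumptions on $y'=-Ay+G(y)+f(t)$ in $\mathbb R^n$: $A$ is a constant real $n\times n$ matrix which is diagonalizable with positive eigenvalues (i.e. $A=S^{-1}A_0S$ with $S$ invertible and $A_0$ diagonal with positive entries). $G:\mathbb R^n\to\mathbb R^n$ is locally Lipschitz,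 and there are functions $G_m:\mathbb R^n\to\mathbb R^n$, $m\ge 2$, each a homogeneous polynomial of degree $m$, such that for every $N\ge 2$ there exists $\delta>0$ with $|G(y)-\sum_{m=2}^NG_m(y)|=\mathcal O(|y|^{N+\delta})$ as $y\to 0$. For each $m\ge 2$, $\mathcal G_m$ is a (fixed) $m$-linear mapping from $(\mathbb R^n)^m$ to $\mathbb R^n$ with $G_m(y)=\mathcal G_m(y,y,\ldots,y)$ for all $y\in\mathbb R^n$. The forcing $f$ is a function from $(0,\infty)$ to $\mathbb R^n$. Asymptotic expansion: $g(t)\sim\sum_{k=1}^\infty t^{-\mu_k}h_k(t)$, where each $h_k(t)$ is a sum, with only finitely many nonzero terms, of functions $p(\ln\ln t)(\ln t)^{-\beta}$ with $p:\mathbb R\to\mathbb R^n$ a polynomial and $\beta\in\mathbb R$, means that for each $N\in\mathbb N$ there is $\mu>\mu_N$ with $|g(t)-\sum_{k=1}^Nt^{-\mu_k}h_k(t)|=\mathcal O(t^{-\mu})$. (The finiteness of the inner sums is part of the meaning of such an expansion.)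
   Formalization: The formula for χ_{k,j} is corrected: if λ with μ_λ+1=μ_k exists but no ℓ has β_ℓ+1=β_j, then χ_{k,j}=μ_λ q_{λ,j} instead of 0; as printed the claim fails, e.g. for n=1, A=1, G=0, μ_k=k, β_j=j−1, y=1/t+1/t². *)

(* Defs.v *)
From HB Require Import structures.
From mathcomp Require Import all_boot all_order all_algebra.
From mathcomp Require Import all_classical all_reals all_analysis.
(* The notations of multinomials clash with those of analysis. *)
From mathcomp Require mpoly.

Set Implicit Arguments.
Unset Strict Implicit.
Unset Printing Implicit Defensive.

Import Order.TTheory GRing.Theory Num.Theory.
Import numFieldNormedType.Exports.

Local Open Scope classical_set_scope.
Local Open Scope ring_scope.

(* All sequences are indexed from 0: [mu k], [beta j], [p k j], [q k j] stand
   for mu_{k+1}, beta_{j+1}, p_{k+1,j+1}, q_{k+1,j+1}. *)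

(* The Euclidean norm; the library norm [`|v|] on matrices is the sup norm,
   which induces the same topology. *)
Definition enorm (R : realType) (n : nat) (v : 'cV[R]_n) : R :=
  Num.sqrt (\sum_(i < n) v i 0 ^+ 2).

Definition preserves_addition (R : realType) (S : set R) : Prop :=
  forall x y : R, S x -> S y -> S (x + y).

Definition preserves_unit_increment (R : realType) (S : set R) : Prop :=
  forall x : R, S x -> S (x + 1).

(* mu_1 > 0 and beta_1 >= 0 are not included. *)
Definition exponent_sequence (R : realType) (s : nat -> R) : Prop :=
  [/\ {homo s : i j / (i < j)%N >-> i < j},
      s k @[k --> \oo] --> +oo,
      preserves_addition (range s)
    & preserves_unit_increment (range s)].

Definition diagonalizable_pos (R : realType) (n : nat) (A : 'M[R]_n) : Prop :=
  exists (S : 'M[R]_n) (d : 'rV[R]_n),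
    [/\ S \in unitmx, forall i, 0 < d 0 i & A = invmx S *m diag_mx d *m S].

Definition locally_lipschitz (R : realType) (n : nat)
    (G : 'cV[R]_n -> 'cV[R]_n) : Prop :=
  forall x : 'cV[R]_n, exists2 r : R, 0 < r & exists L : R,
    forall u v : 'cV[R]_n, enorm (u - x) < r -> enorm (v - x) < r ->
      enorm (G u - G v) <= L * enorm (u - v).

Definition homogeneous_poly (R : realType) (n m : nat)
    (F : 'cV[R]_n -> 'cV[R]_n) : Prop :=
  exists P : 'I_n -> mpoly.mpoly n R,
    forall i,
      (forall s, mpoly.mcoeff s (P i) != 0 -> mpoly.mdeg s = m) /\
      forall v : 'cV[R]_n, F v i 0 = mpoly.meval (fun j => v j 0) (P i).

Definition multilinear_map (R : realType) (n m : nat)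
    (F : ('I_m -> 'cV[R]_n) -> 'cV[R]_n) : Prop :=
  forall (i : 'I_m) (v : 'I_m -> 'cV[R]_n),
    linear (fun u : 'cV[R]_n => F [eta v with i |-> u]).

Definition bigO_at0 (R : realType) (n : nat) (F : 'cV[R]_n -> R) (a : R) :
    Prop :=
  exists r C : R, [/\ 0 < r, 0 < C &
    forall v : 'cV[R]_n, enorm v < r -> F v <= C * enorm v `^ a].

Definition homogeneous_expansion (R : realType) (n : nat)
    (G : 'cV[R]_n -> 'cV[R]_n) (Gm : nat -> 'cV[R]_n -> 'cV[R]_n) : Prop :=
  (forall m, (2 <= m)%N -> homogeneous_poly m (Gm m)) /\
  (forall N : nat, (2 <= N)%N -> exists2 delta : R, 0 < delta &
     bigO_at0 (fun v => enorm (G v - \sum_(2 <= m < N.+1) Gm m v))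
              (N%:R + delta)).

Definition bigO_at_infty (R : realType) (n : nat) (g : R -> 'cV[R]_n)
    (h : R -> R) : Prop :=
  exists T C : R, [/\ 0 < T, 0 < C &
    forall t, T <= t -> enorm (g t) <= C * h t].

Definition vector_poly (R : realType) (n : nat) (F : R -> 'cV[R]_n) : Prop :=
  exists P : 'I_n -> {poly R}, forall x i, F x i 0 = (P i).[x].

(* g(t) ~ sum_k t^(-mu_k) sum_j p_{k,j}(ln ln t) (ln t)^(-beta_j), including
   that the p_{k,j} are polynomials, finitely many of them nonzero for each k;
   the inner sum, over all j, then has finite support. *)
Definition log_power_expansion (R : realType) (n : nat) (mu beta : nat -> R)
    (g : R -> 'cV[R]_n) (p : nat -> nat -> R -> 'cV[R]_n) : Prop :=
  [/\ forall k j, vector_poly (p k j),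
      forall k, finite_set [set j | exists x, p k j x != 0]
    & forall N : nat, exists2 nu : R, mu N < nu &
        bigO_at_infty
          (fun t => g t - \sum_(k < N.+1) t `^ (- mu k) *:
             \sum_(j \in [set: nat]) ln t `^ (- beta j) *: p k j (ln (ln t)))
          (fun t => t `^ (- nu))].

(* The index i with s_i + 1 = s_k, if any (unique when s is injective). *)
Definition unit_pred (R : realType) (s : nat -> R) (k : nat) : option nat :=
  if pselect (exists i, s i + 1 = s k) is left e then Some (projT1 (cid e))
  else None.

(* chi_{k,j} collects the coefficients of t^(-mu_k) (ln t)^(-beta_j) in
     - d/dt [t^(-mu_la) sum_i q_{la,i}(ln ln t) (ln t)^(-beta_i)],
   where mu_la + 1 = mu_k. Differentiating t^(-mu_la) contributes
   mu_la q_{la,j} for every j; differentiating the logarithms contributes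
   - q_{la,l}' + beta_l q_{la,l}, present only if some l has
   beta_l + 1 = beta_j. In particular the first term is kept when there is no
   such l, as happens for the first index j. *)
Definition chi (R : realType) (n : nat) (mu beta : nat -> R)
    (q : nat -> nat -> R -> 'cV[R]_n) (k j : nat) (x : R) : 'cV[R]_n :=
  match unit_pred mu k, unit_pred beta j with
  | Some la, Some l => mu la *: q la j x - derive1 (q la l) x + beta l *: q la l x
  | Some la, None => mu la *: q la j x
  | None, _ => 0
  end.

Definition multi_indices (R : realType) (mu beta : nat -> R) (k j m : nat) :
    set (m.-tuple nat * m.-tuple nat) :=
  [set jl | \sum_(i < m) mu (tnth jl.1 i) = mu k /\
            \sum_(i < m) beta (tnth jl.2 i) = beta j].
Arguments multi_indices {R} mu beta k j m _.

(* Both sums have finite support when mu and beta are increasing to +oo with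
   mu 0 > 0 and beta 0 >= 0. *)
Definition coefficient_recursion (R : realType) (n : nat) (A : 'M[R]_n)
    (cG : forall m, ('I_m -> 'cV[R]_n) -> 'cV[R]_n) (mu beta : nat -> R)
    (p q : nat -> nat -> R -> 'cV[R]_n) : Prop :=
  (forall j x, q 0%N j x = invmx A *m p 0%N j x) /\
  (forall k j x, (0 < k)%N ->
     q k j x = invmx A *m
       (\sum_(m \in [set m | (2 <= m)%N])
          \sum_(jl \in multi_indices mu beta k j m)
            cG m (fun i => q (tnth jl.1 i) (tnth jl.2 i) x)
        + p k j x + chi mu beta q k j x)).

(* Main.v *)
Require Import Defs.
From HB Require Import structures.
From mathcomp Require Import all_boot all_order all_algebra.
From mathcomp Require Import all_classical all_reals all_analysis.
From mathcomp Require Import ring lra.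

Set Implicit Arguments.
Unset Strict Implicit.
Unset Printing Implicit Defensive.

Import Order.TTheory GRing.Theory Num.Theory.
Import numFieldNormedType.Exports.

Local Open Scope classical_set_scope.
Local Open Scope ring_scope.

(** Write [S] for the expansion of [y] truncated after the power [mu N]. Two
    facts give the theorem.

    First, [S] solves the equation up to a residual [O(t ^ - nu)] with
    [nu > mu N] ([residual]). Everything here is a finite sum of terms
    [t ^ - a * (ln t) ^ - b * v (ln (ln t))] with [v] polynomial ([atom]).
    Such terms are stable under derivation ([is_derive_atom]) and under the
    multilinear maps [cG m] ([multilinear_expand]), and since [mu] and [beta]
    preserve the addition and the unit increment, all exponents that arise are
    again values of [mu] and of [beta]. So the terms can be collected by
    exponents ([regroup]). The coefficient found at [mu k], [beta j] is an
    instance of the recursion that defines [q], hence vanishes for [k <= N]; a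
    term with a power of [t] beyond [mu N] beats the slowly varying logarithmic
    factors.

    Secondly, the remainder [y - S] inherits the decay of the residual. The
    eigenvalues of [A] being positive, a solution of [v' = - A v + h] with
    [|h| <= e |v| + C t ^ - nu] and [e] small is itself [O(t ^ - nu)]
    ([linear_decay], an energy estimate in diagonalizing coordinates). Applied to [y]
    itself this yields a crude power decay ([solution_decay]), which makes the
    Taylor remainder of [G] at [y] as small as desired once the degree is large.
    Applied to [y - S] it gives the sharp estimate ([approximation_decay]), since
    the Taylor polynomials of [G] have arbitrarily small Lipschitz constants near
    [0].

    The recursion has a unique solution because the right-hand side for [q k]
    only involves [q i] with [i < k] ([causal_fixpoint]): the degree is at least
    [2] and all [mu i] are positive. That the [q k] are polynomials, finitely
    many of them nonzero for each [k], follows by strong induction along the same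
    recursion. *)

(** * Power-law decay at infinity *)

Section PowerDecay.
Context {R : realType}.
Implicit Types (a b e : R) (V W : normedModType R).

Definition powO V (g : R -> V) (a : R) : Prop :=
  exists C : R, \forall t \near +oo, `|g t| <= C * t `^ (- a).

(** Growth below every positive power, which is all that the estimates use about
    polynomials in [ln (ln t)] and powers of [ln t]. *)
Definition slow V (g : R -> V) : Prop := forall e, 0 < e -> powO g (- e).

Lemma powO_ge0 V (g : R -> V) a :
  powO g a -> exists2 C : R, 0 < C & \forall t \near +oo, `|g t| <= C * t `^ (- a).
Proof.
case=> C hC; exists (`|C| + 1); first by rewrite ltr_wpDl.
near=> t.
have h : `|g t| <= C * t `^ (- a) by near: t.
apply: le_trans h _; rewrite ler_wpM2r ?powR_ge0//.
by rewrite (le_trans (ler_norm C))// lerDl.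
Unshelve. all: by end_near. Qed.

Lemma powO_le V W (g : R -> V) (h : R -> W) a :
  (\forall t \near +oo, `|g t| <= `|h t|) -> powO h a -> powO g a.
Proof.
move=> gh [C hC]; exists C; near=> t.
by apply: (@le_trans _ _ `|h t|); near: t.
Unshelve. all: by end_near. Qed.

Lemma powO_near V (g h : R -> V) a :
  (\forall t \near +oo, g t = h t) -> powO h a -> powO g a.
Proof.
by move=> gh; apply: powO_le; apply: filterS gh => t ->.
Qed.

Lemma powO_weak V (g : R -> V) a b : b <= a -> powO g a -> powO g b.
Proof.
move=> ba /powO_ge0[C C0 hC]; exists C; near=> t.
have h : `|g t| <= C * t `^ (- a) by near: t.
apply: le_trans h _; rewrite ler_wpM2l ?(ltW C0)//.
by rewrite ler_powR ?lerN2//; near: t; exact: nbhs_pinfty_ge.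
Unshelve. all: by end_near. Qed.

Lemma powO0 V a : powO (fun=> (0 : V)) a.
Proof. by exists 0; near=> t; rewrite normr0 mul0r. Unshelve. all: by end_near. Qed.

Lemma powOD V (g h : R -> V) a :
  powO g a -> powO h a -> powO (fun t => g t + h t) a.
Proof.
move=> [C hC] [D hD]; exists (C + D); near=> t.
rewrite mulrDl (le_trans (ler_normD _ _))// lerD//; near: t => //.
Unshelve. all: by end_near. Qed.

Lemma powO_sum V (I : Type) (r : seq I) (P : pred I) (g : I -> R -> V) a :
  (forall i, P i -> powO (g i) a) -> powO (fun t => \sum_(i <- r | P i) g i t) a.
Proof.
move=> ga; elim: r => [|i r IH].
  by apply: powO_near (powO0 V a); near=> t; rewrite big_nil.
case Pi : (P i); last first.
  by apply: powO_near IH; near=> t; rewrite big_cons Pi.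
by apply: powO_near (powOD (ga i Pi) IH); near=> t; rewrite big_cons Pi.
Unshelve. all: by end_near. Qed.

Lemma powOZ V (f : R -> R) (g : R -> V) a b :
  powO f a -> powO g b -> powO (fun t => f t *: g t) (a + b).
Proof.
move=> /powO_ge0[C C0 hC] /powO_ge0[D D0 hD]; exists (C * D); near=> t.
rewrite normrZ opprD powRD; last first.
  by apply/implyP => _; rewrite gt_eqF//; near: t; exact: nbhs_pinfty_gt.
by rewrite mulrACA ler_pM//; near: t.
Unshelve. all: by end_near. Qed.

Lemma powO_powR a : powO (fun t : R => t `^ (- a)) a.
Proof.
by exists 1; near=> t; rewrite mul1r ger0_norm ?powR_ge0.
Unshelve. all: by end_near. Qed.

Lemma powO_cst V (c : V) : powO (fun=> c) 0.
Proof.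
by exists `|c|; near=> t; rewrite oppr0 powRr0 mulr1.
Unshelve. all: by end_near. Qed.

Lemma powO_cvg0 V (g : R -> V) a : 0 < a -> powO g a ->
  forall e, 0 < e -> \forall t \near +oo, `|g t| <= e.
Proof.
move=> a0 /powO_ge0[C C0 hC] e e0; near=> t.
have h : `|g t| <= C * t `^ (- a) by near: t.
have t0 : 0 < t by near: t; exact: nbhs_pinfty_gt.
apply: le_trans h _; rewrite powRN -ler_pdivlMr ?invr_gt0 ?powR_gt0// invrK.
rewrite mulrC -ler_pdivrMr// -[leLHS]powRr1 ?divr_ge0 ?(ltW C0) ?(ltW e0)//.
have -> : 1 = a^-1 * a by rewrite mulVf ?gt_eqF.
by rewrite powRrM; apply: ge0_ler_powR; rewrite ?nnegrE ?powR_ge0 ?(ltW a0) ?(ltW t0).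
Unshelve. all: by end_near. Qed.

(** A slowly varying factor costs an arbitrarily small part of the exponent. *)
Lemma powO_slow V (f : R -> V) a b :
  a < b -> slow f -> powO (fun t : R => t `^ (- b) *: f t) a.
Proof.
move=> ab /(_ (b - a)); rewrite subr_gt0 ab => /(_ isT) h.
by have := powOZ (powO_powR b) h; rewrite opprB addrCA subrr addr0.
Qed.

Lemma slow_near V (g h : R -> V) :
  (\forall t \near +oo, g t = h t) -> slow h -> slow g.
Proof. by move=> gh hs e e0; apply: powO_near gh (hs e e0). Qed.

Lemma slow_cst V (c : V) : slow (fun=> c).
Proof. by move=> e e0; apply: powO_weak (powO_cst c); rewrite oppr_le0 ltW. Qed.

Lemma slow_sum V (I : Type) (r : seq I) (P : pred I) (g : I -> R -> V) :
  (forall i, P i -> slow (g i)) -> slow (fun t => \sum_(i <- r | P i) g i t).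
Proof. by move=> gs e e0; apply: powO_sum => i Pi; exact: gs. Qed.

Lemma slowZ V (f : R -> R) (g : R -> V) :
  slow f -> slow g -> slow (fun t => f t *: g t).
Proof.
move=> fs gs e e0; have e2 : 0 < e / 2 by rewrite divr_gt0.
by have := powOZ (fs _ e2) (gs _ e2); rewrite -opprD -splitr.
Qed.

Lemma slowX (f : R -> R) k : slow f -> slow (fun t => f t ^+ k).
Proof.
move=> fs; elim: k => [|k IH].
  by apply: slow_near (slow_cst (1 : R)); near=> t; rewrite expr0.
by apply: slow_near (slowZ fs IH); near=> t; rewrite exprS.
Unshelve. all: by end_near. Qed.

(** This is [ln s < s] at [s = t `^ e]. *)
Lemma ln_le_powR e : 0 < e -> \forall t \near +oo, ln t <= e^-1 * t `^ e.
Proof.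
move=> e0; near=> t; rewrite ler_pdivlMl// -ln_powR ltW// ln_sublinear//.
by rewrite powR_gt0//; near: t; exact: nbhs_pinfty_gt.
Unshelve. all: by end_near. Qed.

Lemma ln_ge1 : \forall t \near +oo_R, 1 <= ln t.
Proof.
near=> t; by rewrite -[leLHS]expRK ler_ln ?posrE ?expR_gt0.
Unshelve. all: by end_near. Qed.

Lemma slow_ln_powR b : slow (fun t : R => ln t `^ b).
Proof.
move=> e e0; have [b0|b0] := leP b 0.
  apply: powO_le (slow_cst (1 : R) e0); near=> t.
  rewrite normr1 ger0_norm ?powR_ge0// -(powRr0 (ln t)) ler_powR//.
  by near: t; exact: ln_ge1.
have eb : 0 < e / b by rewrite divr_gt0.
exists ((e / b)^-1 `^ b); near=> t.
rewrite ger0_norm ?powR_ge0// opprK.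
have l1 : 1 <= ln t by near: t; exact: ln_ge1.
have h : ln t <= (e / b)^-1 * t `^ (e / b) by near: t; exact: ln_le_powR.
rewrite -[X in t `^ X](@divfK _ b) ?gt_eqF// powRrM -powRM ?powR_ge0 ?invr_ge0 ?(ltW eb)//.
by rewrite ge0_ler_powR ?nnegrE ?(ltW b0)// (le_trans ler01)// (le_trans l1).
Unshelve. all: by end_near. Qed.

Lemma slow_lnln : slow (fun t : R => ln (ln t)).
Proof.
move=> e e0; apply: powO_le (slow_ln_powR 1 e0); near=> t.
have l1 : 1 <= ln t by near: t; exact: ln_ge1.
rewrite powRr1 ?(le_trans ler01)// !ger0_norm ?ln_ge0 ?(le_trans ler01)//.
by rewrite ltW// ln_sublinear// (lt_le_trans ltr01).
Unshelve. all: by end_near. Qed.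

Lemma slow_poly (P : {poly R}) : slow (fun t : R => P.[ln (ln t)]).
Proof.
apply: slow_near (fun t => \sum_(i < size P) P`_i *: ln (ln t) ^+ i) _ _.
  by near=> t; rewrite horner_coef.
by apply: slow_sum => i _; apply: slowZ; [exact: slow_cst|exact/slowX/slow_lnln].
Unshelve. all: by end_near. Qed.

End PowerDecay.

(** * Norms of column vectors *)

Section ColumnNorms.
Context {R : realType}.

Lemma le_entry_norm m n (M : 'M[R]_(m, n)) i j : `|M i j| <= `|M|.
Proof.
by rewrite [leRHS]/Num.Def.normr/= mx_normrE; exact: (le_bigmax _ _ (i, j)).
Qed.

Lemma norm_mx_le m n (M : 'M[R]_(m, n)) (c : R) :
  0 <= c -> (forall i j, `|M i j| <= c) -> `|M| <= c.
Proof.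
move=> c0 Mc; rewrite [leLHS]/Num.Def.normr/= mx_normrE.
by apply: bigmax_le => // -[i j] _; exact: Mc.
Qed.

(** [`|v|] is the maximum norm, which a sum of [n] products bounds with the
    factor [n]. *)
Lemma norm_mulmx_le n (M : 'M[R]_n) (v : 'cV[R]_n) :
  `|M *m v| <= n%:R * `|M| * `|v|.
Proof.
apply: norm_mx_le; first by rewrite !mulr_ge0.
move=> i j; rewrite !mxE (le_trans (ler_norm_sum _ _ _))//.
apply: (@le_trans _ _ (\sum_(k < n) `|M| * `|v|)).
  by apply: ler_sum => k _; rewrite normrM ler_pM// le_entry_norm.
by rewrite sumr_const card_ord -mulrA mulr_natl.
Qed.

Lemma enorm_ge0 n (v : 'cV[R]_n) : 0 <= enorm v.
Proof. exact: sqrtr_ge0. Qed.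

Lemma norm_le_enorm n (v : 'cV[R]_n) : `|v| <= enorm v.
Proof.
apply: norm_mx_le; first exact: enorm_ge0.
move=> i j; rewrite (ord1 j) -sqrtr_sqr ler_wsqrtr//.
by rewrite (bigD1 i)//= lerDl sumr_ge0// => k _; exact: sqr_ge0.
Qed.

Lemma enorm_le_norm n (v : 'cV[R]_n) : enorm v <= n%:R * `|v|.
Proof.
rewrite -[leRHS]ger0_norm ?mulr_ge0// -sqrtr_sqr ler_wsqrtr//.
apply: (@le_trans _ _ (\sum_(k < n) `|v| ^+ 2)).
  apply: ler_sum => k _; rewrite -real_normK ?num_real// lerXn2r ?nnegrE//.
  exact: le_entry_norm.
rewrite sumr_const card_ord exprMn -[leLHS]mulr_natl ler_wpM2r ?sqr_ge0//.
by rewrite -natrX ler_nat; case: n {v} => // n; rewrite -mulnn leq_pmulr.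
Qed.

End ColumnNorms.

(** * Decay of solutions of a stable linear equation *)

Section Decay.
Context {R : realType}.

Lemma is_derive_entry m n (M : R -> 'M[R]_(m, n)) (t : R) (D : 'M[R]_(m, n)) i j :
  is_derive t 1 M D -> is_derive t 1 (fun s => M s i j) (D i j).
Proof.
case=> dM <-; rewrite derive_mx// mxE.
by apply: derivableP; move/derivable_mxP : dM.
Qed.

Lemma is_derive_matrix m n (M : R -> 'M[R]_(m, n)) (t : R) (D : 'M[R]_(m, n)) :
  (forall i j, is_derive t 1 (fun s => M s i j) (D i j)) -> is_derive t 1 M D.
Proof.
move=> dM; have dM' : derivable M t 1.
  by apply/derivable_mxP => i j; exact: ex_derive.
apply: DeriveDef => //; rewrite derive_mx//; apply/matrixP => i j.
by rewrite mxE derive_val.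
Qed.

(** The function [expR (c * t) * (u t - K / c)] is nonincreasing. *)
Lemma gronwall_bounded (u u' : R -> R) (T c K : R) : 0 < c ->
  (forall t, T <= t -> is_derive t 1 u (u' t)) ->
  (forall t, T <= t -> u' t <= - c * u t + K) ->
  forall t, T <= t -> u t <= `|u T - K / c| + K / c.
Proof.
move=> c0 du u'le t Tt.
pose g (s : R) := expR (c * s) * (u s - K / c).
pose g' (s : R) := expR (c * s) * (c * (u s - K / c) + u' s).
have dg s : T <= s -> is_derive s 1 g (g' s).
  move=> Ts; have := du _ Ts => dus.
  have d1 : is_derive s 1 (fun s : R => expR (c * s)) (expR (c * s) * c).
    apply: (@is_derive1_comp _ (@expR R) (fun s => c * s)).
    have := @is_deriveZ R _ _ id c s 1 1 (is_derive_id s 1).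
    by move=> h; apply: (is_derive_eq h); rewrite scaler1.
  have d2 : is_derive s 1 (fun s => u s - K / c) (u' s).
    have := @is_deriveB _ _ _ u (cst (K / c)) s 1 (u' s) 0 dus (is_derive_cst _ _ _).
    by rewrite subr0.
  have := is_deriveM d1 d2; move=> h; apply: (is_derive_eq h).
  by rewrite /g' /GRing.scale/=; ring.
have gle : g t <= g T.
  have [c1 c1T E] : exists2 x, x \in `[T, t] & g t - g T = g' x * (t - T).
    apply: MVT_segment => // [x|].
      by rewrite in_itv/= => /andP[/ltW/dg].
    apply: derivable_within_continuous => x; rewrite in_itv/= => /andP[Tx _].
    by have [] := dg _ Tx.
  rewrite -subr_le0 E mulr_le0_ge0 ?subr_ge0// pmulr_rle0 ?expR_gt0//.
  move: c1T; rewrite in_itv/= => /andP[/u'le h _].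
  rewrite mulrBr mulrCA divff ?gt_eqF// mulr1; lra.
rewrite -lerBlDr.
have : expR (c * t) * (u t - K / c) <= expR (c * t) * `|u T - K / c|.
  apply: (le_trans gle); rewrite /g.
  apply: (@le_trans _ _ (expR (c * T) * `|u T - K / c|)).
    by rewrite ler_wpM2l ?expR_ge0 ?ler_norm.
  by rewrite ler_wpM2r// ler_expR ler_wpM2l// ltW.
by rewrite ler_pM2l ?expR_gt0.
Qed.

End Decay.

Section LinearDecay.
Context {R : realType}.

Lemma positive_lower_bound n (d : 'rV[R]_n) : (forall i, 0 < d 0 i) ->
  exists2 d0 : R, 0 < d0 & forall i, d0 <= d 0 i.
Proof.
move=> dpos; exists (\big[Num.min/1]_i d 0 i).
  by apply: lt_bigmin.
by move=> i; exact: bigmin_le.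
Qed.

(** The energy [t `^ (2 * nu) * \sum_i z_i ^+ 2], where [z = S *m v] diagonalizes
    the equation, satisfies a Gronwall inequality: the smallest eigenvalue beats
    both the small multiple of [v] and the derivative of the weight. *)
Lemma linear_decay n (A : 'M[R]_n) : diagonalizable_pos A ->
  exists2 e : R, 0 < e & forall (v h : R -> 'cV[R]_n) (nu C : R), 0 <= nu ->
    (\forall t \near +oo, is_derive (t : R) 1 v (- (A *m v t) + h t)) ->
    (\forall t \near +oo, `|h t| <= e * `|v t| + C * t `^ (- nu)) ->
    powO v nu.
Proof.
move=> [S [d [Su dpos AE]]].
have [d0 d0_gt0 d0le] := positive_lower_bound dpos.
pose K1 := n%:R * `|invmx S|; pose K2 := n%:R * `|S|.
have K1_ge0 : 0 <= K1 by rewrite mulr_ge0.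
have K2_ge0 : 0 <= K2 by rewrite mulr_ge0.
pose a := 2 * n%:R * K2.
have a_ge0 : 0 <= a by rewrite !mulr_ge0.
(* The change of coordinates and its inverse cost [K2] and [K1]; this [e] makes
   the part of [h] proportional to [v] take at most a quarter of the dissipation
   [2 * d0 * w]. *)
pose e := d0 / (2 * (a * K1 + 1)).
have aK_gt0 : 0 < a * K1 + 1 by rewrite ltr_wpDl// mulr_ge0.
have e_gt0 : 0 < e by rewrite divr_gt0// mulr_gt0.
have eE : a * K1 * e <= d0 / 2.
  have -> : a * K1 * e = d0 / 2 * ((a * K1) / (a * K1 + 1)).
    by rewrite /e invfM; ring.
  by rewrite -[leRHS]mulr1 ler_wpM2l ?divr_ge0 ?(ltW d0_gt0)// ler_pdivrMr// mul1r lerDl.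
exists e => // v h nu C nu_ge0 dv hle.
pose z t := S *m v t.
have vE t : v t = invmx S *m z t by rewrite mulmxA mulVmx// mul1mx.
have vz t : `|v t| <= K1 * `|z t| by rewrite {1}vE norm_mulmx_le.
pose w t := \sum_i z t i 0 ^+ 2.
have zw t : `|z t| ^+ 2 <= w t.
  have := norm_le_enorm (z t) => /(lerXn2r 2); rewrite !nnegrE => /(_ (normr_ge0 _) (enorm_ge0 _)).
  by rewrite sqr_sqrtr// sumr_ge0// => i _; exact: sqr_ge0.
have w_ge0 t : 0 <= w t by rewrite sumr_ge0// => i _; exact: sqr_ge0.
pose w' t := \sum_i 2 * (z t i 0 * (- d 0 i * z t i 0 + (S *m h t) i 0)).
have dz (t : R) : is_derive t 1 v (- (A *m v t) + h t) -> forall i,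
    is_derive t 1 (fun s => z s i 0) (- d 0 i * z t i 0 + (S *m h t) i 0).
  move=> dvt i.
  have -> : (fun s => z s i 0) = \sum_j (S i j \*: (fun s : R => v s j 0) : R -> R).
    by apply/funext => s; rewrite fct_sumE mxE.
  have -> : - d 0 i * z t i 0 + (S *m h t) i 0 =
      \sum_j S i j *: (- (A *m v t) + h t) j 0.
    transitivity ((S *m (- (A *m v t) + h t)) i 0); last by rewrite mxE.
    rewrite mulmxDr mulmxN AE !mulmxA mulmxV// mul1mx -mulmxA mul_diag_mx.
    by rewrite -/(z t) [RHS]mxE; congr (_ + _); rewrite [RHS]mxE [in RHS]mxE mulNr.
  by apply: is_derive_sum => j; apply: is_deriveZ; exact: is_derive_entry.
have dw (t : R) : is_derive t 1 v (- (A *m v t) + h t) -> is_derive t 1 w (w' t).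
  move=> dvt.
  have -> : w = \sum_i ((fun s => z s i 0) * (fun s => z s i 0)).
    by apply/funext => s; rewrite fct_sumE; apply: eq_bigr => i _; rewrite expr2.
  apply: is_derive_sum => i; have dzi := dz _ dvt i.
  apply: (is_derive_eq (is_deriveM dzi dzi)).
  by rewrite /GRing.scale/=; ring.
pose C' := (a * C) ^+ 2 / (2 * d0).
have w'le t : `|h t| <= e * `|v t| + C * t `^ (- nu) ->
    w' t <= - d0 * w t + C' * (t `^ (- nu)) ^+ 2.
  move=> ht.
  have h1 : w' t <= - 2 * d0 * w t + 2 * n%:R * (`|z t| * `|S *m h t|).
    have -> : 2 * n%:R * (`|z t| * `|S *m h t|) =
        \sum_(i < n) 2 * (`|z t| * `|S *m h t|).
      by rewrite sumr_const card_ord -[RHS]mulr_natr; ring.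
    rewrite /w' /w mulr_sumr -big_split/=; apply: ler_sum => i _.
    rewrite mulrDr mulrDr lerD//.
      have := d0le i; have := sqr_ge0 (z t i 0); nra.
    rewrite ler_pM2l// (le_trans (ler_norm _))// normrM.
    by rewrite ler_pM// le_entry_norm.
  have h2 : `|S *m h t| <= K2 * (e * (K1 * `|z t|) + C * t `^ (- nu)).
    apply: (le_trans (norm_mulmx_le _ _)); rewrite ler_wpM2l//.
    by apply: (le_trans ht); rewrite lerD2r ler_wpM2l ?(ltW e_gt0).
  set Z := `|z t| in h1 h2 *; have Z_ge0 : 0 <= Z by exact: normr_ge0.
  have ZW : Z ^+ 2 <= w t by exact: zw.
  set tn := t `^ (- nu) in h2 *.
  have h3 : 2 * n%:R * (Z * `|S *m h t|) <= a * K1 * e * Z ^+ 2 + a * C * (Z * tn).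
    have -> : a * K1 * e * Z ^+ 2 + a * C * (Z * tn) =
      2 * n%:R * (Z * (K2 * (e * (K1 * Z) + C * tn))) by rewrite /a; ring.
    by rewrite ler_wpM2l ?mulr_ge0// ler_wpM2l.
  have h4 : a * K1 * e * Z ^+ 2 <= d0 / 2 * w t.
    apply: ler_pM => //; last exact: sqr_ge0.
    exact: (mulr_ge0 (mulr_ge0 a_ge0 K1_ge0) (ltW e_gt0)).
  (* Young's inequality absorbs the inhomogeneous term. *)
  have h5 : a * C * (Z * tn) <= d0 / 2 * w t + C' * tn ^+ 2.
    apply: (@le_trans _ _ (d0 / 2 * Z ^+ 2 + C' * tn ^+ 2)); last first.
      by rewrite lerD2r ler_wpM2l// divr_ge0// ltW.
    rewrite -subr_ge0 /C'.
    have -> : d0 / 2 * Z ^+ 2 + (a * C) ^+ 2 / (2 * d0) * tn ^+ 2 - a * C * (Z * tn) =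
      (d0 * Z - a * C * tn) ^+ 2 / (2 * d0) by field; rewrite gt_eqF.
    by rewrite divr_ge0 ?sqr_ge0// mulr_ge0// ltW.
  lra.
pose u t := t `^ (2 * nu) * w t.
pose u' t := 2 * nu * t `^ (2 * nu - 1) * w t + t `^ (2 * nu) * w' t.
have du (t : R) : 0 < t -> is_derive t 1 v (- (A *m v t) + h t) -> is_derive t 1 u (u' t).
  move=> t0 /dw dwt.
  apply: (is_derive_eq (is_deriveM (is_derive1_powR (2 * nu) t0) dwt)).
  by rewrite /u' /GRing.scale/=; ring.
have C'_ge0 : 0 <= C' by rewrite divr_ge0 ?sqr_ge0// mulr_ge0// ltW.
(* From [4 * nu / d0] on, the derivative of the weight costs at most [d0 / 2]. *)
have [T [T1 Tnu TH]] : exists T : R, [/\ 1 <= T, 4 * nu / d0 <= T & forall t, T <= t ->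
    is_derive t 1 v (- (A *m v t) + h t) /\
    `|h t| <= e * `|v t| + C * t `^ (- nu)].
  have [M [Mr MH]] := (filterI dv hle).
  exists (Num.max (Num.max 1 (4 * nu / d0)) (M + 1)); split.
  - by rewrite !le_max lexx.
  - by rewrite !le_max lexx orbT.
  - by move=> t; rewrite ge_max => /andP[_ Mt]; apply: MH; rewrite (lt_le_trans _ Mt)// ltrDl.
have u'le t : T <= t -> u' t <= - (d0 / 2) * u t + C'.
  move=> Tt; have [_ /w'le h1] := TH _ Tt.
  have t0 : 0 < t by rewrite (lt_le_trans ltr01)// (le_trans T1).
  have p0 : 0 < t `^ (2 * nu) by exact: powR_gt0.
  have E1 : t `^ (2 * nu - 1) = t `^ (2 * nu) / t.
    by rewrite powRB ?powRr1 ?(ltW t0)// (gt_eqF t0) implybT.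
  have E2 : t `^ (2 * nu) * (t `^ (- nu)) ^+ 2 = 1.
    have -> : 2 * nu = nu + nu by ring.
    rewrite powRD ?(gt_eqF t0) ?implybT// powRN exprVn expr2.
    by rewrite divff// mulf_neq0// gt_eqF// powR_gt0.
  have h2 : t `^ (2 * nu) * w' t <= - d0 * u t + C'.
    apply: (@le_trans _ _ (t `^ (2 * nu) * (- d0 * w t + C' * (t `^ (- nu)) ^+ 2))).
      by rewrite ler_wpM2l// ltW.
    by rewrite mulrDr (mulrCA _ C') E2 mulr1 mulrCA.
  have h3 : 2 * nu * t `^ (2 * nu - 1) * w t <= d0 / 2 * u t.
    have -> : 2 * nu * t `^ (2 * nu - 1) * w t = 2 * nu / t * u t.
      by rewrite E1 /u; ring.
    rewrite ler_wpM2r ?mulr_ge0 ?(ltW p0)// ler_pdivrMr//.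
    have : 4 * nu / d0 <= t by exact: le_trans Tt.
    by rewrite ler_pdivrMr//; lra.
  rewrite /u'; lra.
have T0 t : T <= t -> 0 < t.
  by move=> Tt; rewrite (lt_le_trans ltr01)// (le_trans T1).
have := gronwall_bounded (divr_gt0 d0_gt0 (ltr0n R 2))
  (fun t Tt => du t (T0 t Tt) (proj1 (TH t Tt))) u'le.
set M := `|_| + _ => uM.
exists (K1 * Num.sqrt M); near=> t.
have Tt : T <= t by near: t; apply: nbhs_pinfty_ge; exact: num_real.
have t0 := T0 t Tt.
apply: (le_trans (vz t)); rewrite -[leRHS]mulrA ler_wpM2l//.
rewrite powRN ler_pdivlMr ?powR_gt0// -[leLHS]ger0_norm ?mulr_ge0 ?powR_ge0//.
rewrite -sqrtr_sqr ler_wsqrtr// exprMn.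
apply: le_trans (uM t Tt); rewrite /u mulrC.
have -> : (t `^ nu) ^+ 2 = t `^ (2 * nu).
  by rewrite expr2 -powRD ?(gt_eqF t0) ?implybT//; congr (_ `^ _); ring.
by rewrite ler_wpM2l// powR_ge0.
Unshelve. all: by end_near. Qed.

End LinearDecay.

(** * Multilinear maps *)

Section Multilinear.
Context {R : realType} {n : nat}.
Implicit Types (m : nat).

Lemma multilinear_ext m (F : ('I_m -> 'cV[R]_n) -> 'cV[R]_n) u v :
  (forall i, u i = v i) -> F u = F v.
Proof. by move=> uv; congr F; exact/funext. Qed.

(** The function [[eta v with i |-> x]], in a form that stays folded when [v] is
    itself an abstraction. *)
Definition upd m (v : 'I_m -> 'cV[R]_n) (i : 'I_m) (x : 'cV[R]_n) : 'I_m -> 'cV[R]_n :=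
  fun j => if j == i then x else v j.

Section Fixed.
Variables (m : nat) (F : ('I_m -> 'cV[R]_n) -> 'cV[R]_n).
Hypothesis Fm : multilinear_map F.

Lemma multilinearP (i : 'I_m) v (a : R) x y :
  F (upd v i (a *: x + y)) = a *: F (upd v i x) + F (upd v i y).
Proof.
have E u : upd v i u = [eta v with i |-> u] by apply/funext => j; rewrite /upd/=.
by rewrite !E; exact: Fm.
Qed.

Lemma multilinear0 i v : F (upd v i 0) = 0.
Proof.
have := multilinearP i v 1 0 0; rewrite scaler0 addr0 scale1r => /eqP.
by rewrite -subr_eq subrr eq_sym => /eqP.
Qed.

Lemma multilinear_eq0 i v : v i = 0 -> F v = 0.
Proof.
move=> vi; rewrite -(multilinear0 i v); apply: multilinear_ext => j; rewrite /upd.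
by case: eqP => [->|].
Qed.

Lemma multilinear_sum i v (I : Type) (r : seq I) (w : I -> 'cV[R]_n) :
  F (upd v i (\sum_(a <- r) w a)) = \sum_(a <- r) F (upd v i (w a)).
Proof.
elim: r => [|a r IH]; first by rewrite !big_nil multilinear0.
by rewrite !big_cons -IH -[w a in LHS]scale1r multilinearP scale1r.
Qed.

Lemma multilinearZ i v (a : R) x :
  F (upd v i (a *: x)) = a *: F (upd v i x).
Proof. by rewrite -[a *: x in LHS]addr0 multilinearP multilinear0 addr0. Qed.

Lemma multilinear_scale (c : 'I_m -> R) w :
  F (fun i => c i *: w i) = (\prod_i c i) *: F w.
Proof.
suff H (s : seq 'I_m) v : uniq s ->
    F (fun i => if i \in s then c i *: v i else v i) = (\prod_(i <- s) c i) *: F v.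
  transitivity (F (fun i => if i \in enum 'I_m then c i *: w i else w i)).
    by apply: multilinear_ext => i; rewrite mem_enum.
  by rewrite H ?enum_uniq// big_enum.
elim: s v => [|i s IH] v /=; first by rewrite big_nil scale1r.
move=> /andP[is_ us]; rewrite big_cons -scalerA -(IH _ us).
transitivity (F (upd (fun j => if j \in s then c j *: v j else v j) i (c i *: v i))).
  by apply: multilinear_ext => j; rewrite /upd inE; case: eqP => [->//|_].
rewrite multilinearZ; congr (_ *: _); apply: multilinear_ext => j; rewrite /upd.
by case: eqP => [->|//]; rewrite (negbTE is_).
Qed.

(** Full distributivity, obtained by opening the arguments in the list [s] one
    at a time; [a0] is the value of [phi] outside of [s]. *)
Lemma multilinear_expand (I : finType) (a0 : I) (w : 'I_m -> I -> 'cV[R]_n) :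
  F (fun i => \sum_a w i a) = \sum_(phi : {ffun 'I_m -> I}) F (fun i => w i (phi i)).
Proof.
suff H (s : seq 'I_m) v : uniq s ->
    F (fun i => if i \in s then \sum_a w i a else v i) =
    \sum_(phi in pfamily a0 (mem s) (fun=> predT))
      F (fun i => if i \in s then w i (phi i) else v i).
  transitivity (F (fun i => if i \in enum 'I_m then \sum_a w i a else 0)).
    by apply: multilinear_ext => i; rewrite mem_enum.
  rewrite H ?enum_uniq//; apply: eq_big => [phi|phi _].
    by apply/pfamilyP; split => //; apply/fintype.subsetP => i _; rewrite mem_enum.
  by apply: multilinear_ext => i; rewrite mem_enum.
elim: s v => [|i s IH] v /=.
  rewrite (big_pred1 [ffun=> a0])//= => phi; apply/pfamilyP/eqP => [[/fintype.subsetP h _]|->].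
    by apply/ffunP => i; rewrite ffunE; apply/eqP; apply: contraT => /(h i).
  by split => //; apply/fintype.subsetP => i; rewrite !inE ffunE eqxx.
move=> /andP[is_ us].
transitivity (F (upd (fun j => if j \in s then \sum_a w j a else v j) i (\sum_a w i a))).
  by apply: multilinear_ext => j; rewrite /upd inE; case: eqP => [->//|_].
rewrite multilinear_sum (partition_big (fun phi : {ffun 'I_m -> I} => phi i) predT)//=.
apply: eq_bigr => a _.
transitivity (F (fun j => if j \in s then \sum_a w j a else upd v i (w i a) j)).
  apply: multilinear_ext => j; rewrite /upd; case: eqP => [->|//]; by rewrite (negbTE is_).
rewrite IH//.
rewrite [RHS](reindex_onto (fun phi : {ffun 'I_m -> I} => [ffun j => if j == i then a else phi j])
  (fun phi : {ffun 'I_m -> I} => [ffun j => if j == i then a0 else phi j])); last first.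
  move=> phi /andP[_ /eqP phia]; apply/ffunP => j; rewrite !ffunE.
  by case: eqP => [->|].
apply: eq_big => [phi|phi _]; last first.
  apply: multilinear_ext => j; rewrite /upd inE ffunE.
  by case: eqP => [->|_]//=; rewrite (negbTE is_).
rewrite !ffunE eqxx eqxx andbT.
apply/pfamilyP/andP => [[/fintype.subsetP h _]|[/pfamilyP[/fintype.subsetP h _] /eqP e]].
  split; first (apply/pfamilyP; split => //; apply/fintype.subsetP => j).
    by rewrite !inE ffunE; case: (eqVneq j i) => //= _; exact: h.
  apply/eqP/ffunP => j; rewrite !ffunE; case: eqP => // ->.
  by apply/eqP; rewrite eq_sym; apply: contraNT is_ => hi; exact: h.
split => //; apply/fintype.subsetP => j hj; have := h j; rewrite !inE ffunE.
have ji : j != i.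
  by apply: contraTneq hj => ji; rewrite inE negbK -e !ffunE ji eqxx.
by rewrite (negbTE ji)/=; apply.
Qed.

Hypothesis n_gt0 : (0 < n)%N.

Lemma col_delta (v : 'cV[R]_n) : v = \sum_j v j 0 *: delta_mx j 0.
Proof.
rewrite {1}(matrix_sum_delta v); apply: eq_bigr => j _.
by rewrite big_ord1.
Qed.

Lemma multilinear_basis v : F v =
  \sum_(phi : {ffun 'I_m -> 'I_n})
     (\prod_i v i (phi i) 0) *: F (fun i => delta_mx (phi i) 0).
Proof.
transitivity (F (fun i => \sum_j v i j 0 *: delta_mx j 0)).
  by apply: multilinear_ext => i; exact: col_delta.
rewrite (multilinear_expand (Ordinal n_gt0)); apply: eq_bigr => phi _.
by rewrite multilinear_scale.
Qed.

(** Expand all arguments in the standard basis. *)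
Lemma multilinear_bound : exists2 K : R, 0 < K &
  forall v, `|F v| <= K * \prod_i `|v i|.
Proof.
pose K := \sum_(phi : {ffun 'I_m -> 'I_n}) `|F (fun i => delta_mx (phi i) 0)|.
have K0 : 0 <= K by exact: sumr_ge0.
exists (K + 1); first by rewrite ltr_wpDl.
move=> v; apply: (@le_trans _ _ (K * \prod_i `|v i|)); last first.
  by rewrite ler_wpM2r ?lerDl// prodr_ge0.
rewrite multilinear_basis (le_trans (ler_norm_sum _ _ _))// mulr_suml.
apply: ler_sum => phi _; rewrite normrZ mulrC ler_wpM2l// normr_prod.
by apply: ler_prod => i _; rewrite normr_ge0 le_entry_norm.
Qed.

(** Change the arguments from [z] to [y] one at a time. Each step has the factor
    [y - z] and, since [2 <= m], another factor of norm at most [r]. *)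
Lemma multilinear_lipschitz : (2 <= m)%N -> exists2 K : R, 0 < K &
  forall (y z : 'cV[R]_n) (r : R), 0 <= r -> r <= 1 -> `|y| <= r -> `|z| <= r ->
    `|F (fun=> y) - F (fun=> z)| <= K * r * `|y - z|.
Proof.
move=> m2; have [K K0 HK] := multilinear_bound.
exists (m%:R * K); first by rewrite mulr_gt0// ltr0n (leq_trans _ m2).
move=> y z r r0 r1 yr zr.
pose D k := F (fun i : 'I_m => if (i < k)%N then y else z).
have -> : F (fun=> y) - F (fun=> z) = D m - D 0%N.
  by congr (_ - _); apply: multilinear_ext => i; rewrite ?ltn_ord.
rewrite -(telescope_sumr D (leq0n m)) big_mkord (le_trans (ler_norm_sum _ _ _))//.
apply: (@le_trans _ _ (\sum_(k < m) K * (r * `|y - z|))); last first.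
  by rewrite sumr_const card_ord -[leLHS]mulr_natl !mulrA.
apply: ler_sum => k _.
pose v (i : 'I_m) := if (i < k)%N then y else z.
have -> : D k.+1 - D k = F (upd v k (y - z)).
  have := multilinearP k v (-1) z y; rewrite !scaleN1r addrC => ->.
  rewrite [RHS]addrC; congr (_ - _); apply: multilinear_ext => i; rewrite /upd /v.
    by rewrite ltnS leq_eqVlt (val_eqE i k); case: (eqVneq i k) => [->|_].
  by case: eqP => // ->; rewrite ltnn.
apply: (le_trans (HK _)); rewrite ler_wpM2l ?(ltW K0)//.
rewrite /upd (bigD1 k)//= eqxx mulrC ler_wpM2r//.
have [k' k'k] : exists k' : 'I_m, k' != k.
  have m0 : (0 < m)%N by exact: ltn_trans m2.
  case: (eqVneq (Ordinal m0) k) => [k0|]; last by exists (Ordinal m0).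
  by exists (Ordinal m2); rewrite -k0.
have vr i : `|v i| <= r by rewrite /v; case: ifP.
rewrite (bigD1 k')//= (negbTE k'k) -[leRHS]mulr1 ler_pM//; first exact: prodr_ge0.
apply: prodr_ile1 => i /andP[ik _]; rewrite (negbTE ik) normr_ge0/=.
exact: le_trans r1.
Qed.

End Fixed.

Lemma vector_poly_cst (c : 'cV[R]_n) : vector_poly (fun=> c).
Proof. by exists (fun i => (c i 0)%:P) => x i; rewrite hornerC. Qed.

Lemma vector_polyD (f g : R -> 'cV[R]_n) :
  vector_poly f -> vector_poly g -> vector_poly (fun x => f x + g x).
Proof.
move=> [P fP] [Q gQ]; exists (fun i => P i + Q i) => x i.
by rewrite hornerD mxE fP gQ.
Qed.

Lemma vector_polyZ (c : R) (f : R -> 'cV[R]_n) :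
  vector_poly f -> vector_poly (fun x => c *: f x).
Proof.
by move=> [P fP]; exists (fun i => c *: P i) => x i; rewrite hornerZ mxE fP.
Qed.

Lemma vector_poly_sum (I : Type) (r : seq I) (P : pred I) (f : I -> R -> 'cV[R]_n) :
  (forall i, P i -> vector_poly (f i)) ->
  vector_poly (fun x => \sum_(i <- r | P i) f i x).
Proof.
move=> h; elim: r => [|i r IH].
  by under eq_fun do rewrite big_nil; exact: vector_poly_cst.
case Pi : (P i); last by under eq_fun do rewrite big_cons Pi.
by under eq_fun do rewrite big_cons Pi; apply: vector_polyD => //; exact: h.
Qed.

Lemma vector_poly_mulmx (A : 'M[R]_n) (f : R -> 'cV[R]_n) :
  vector_poly f -> vector_poly (fun x => A *m f x).
Proof.
move=> [P fP]; exists (fun i => \sum_j A i j *: P j) => x i.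
by rewrite mxE horner_sum; apply: eq_bigr => j _; rewrite hornerZ fP.
Qed.

Lemma vector_poly_derive (f : R -> 'cV[R]_n) : vector_poly f ->
  vector_poly (derive1 f) /\ forall x : R, is_derive x 1 f (derive1 f x).
Proof.
move=> [P fP].
pose f' x : 'cV[R]_n := \col_i (P i)^`().[x].
have df (x : R) : is_derive x 1 f (f' x).
  apply: is_derive_matrix => i j; rewrite (ord1 j) mxE.
  have -> : (fun s => f s i 0) = horner (P i) by apply/funext => s; rewrite fP.
  exact: is_derive_poly.
have E : derive1 f = f' by apply/funext => x; rewrite derive1E; have [] := df x.
split; first by exists (fun i => (P i)^`()) => x i; rewrite E mxE.
by move=> x; rewrite E.
Qed.

(** In the standard basis, the coefficients are products of entries. *)
Lemma vector_poly_multilinear m (F : ('I_m -> 'cV[R]_n) -> 'cV[R]_n)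
    (f : 'I_m -> R -> 'cV[R]_n) : (0 < n)%N -> multilinear_map F ->
  (forall i, vector_poly (f i)) -> vector_poly (fun x => F (fun i => f i x)).
Proof.
move=> n0 Fm /choice[P fP].
under eq_fun do rewrite (multilinear_basis Fm n0).
apply: vector_poly_sum => phi _.
exists (fun j => F (fun i => delta_mx (phi i) 0) j 0 *: \prod_i P i (phi i)) => x j.
rewrite mxE hornerZ horner_prod mulrC; congr (_ * _).
by apply: eq_bigr => i _; rewrite fP.
Qed.

Lemma slow_vector_poly (f : R -> 'cV[R]_n) :
  vector_poly f -> slow (fun t => f (ln (ln t))).
Proof.
move=> [P fP].
have -> : (fun t => f (ln (ln t))) =
    (fun t => \sum_j (P j).[ln (ln t)] *: (delta_mx j 0 : 'cV[R]_n)).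
  apply/funext => t; rewrite [LHS]col_delta.
  by apply: eq_bigr => j _; rewrite fP.
apply: slow_sum => j _; apply: slowZ; [exact: slow_poly|exact: slow_cst].
Qed.

End Multilinear.

(** * The coefficient recursion *)

Section Exponents.
Context {R : realType}.
Implicit Types (s mu beta : nat -> R).

Lemma exponent_le s : exponent_sequence s -> {mono s : i j / (i <= j)%N >-> i <= j}.
Proof. by case=> homo_s _ _ _; exact: (@le_mono _ _ nat R s homo_s). Qed.

Lemma exponent_lt s : exponent_sequence s -> {mono s : i j / (i < j)%N >-> i < j}.
Proof. by move=> hs i j; rewrite !ltNge (exponent_le hs) -ltnNge. Qed.

Lemma exponent_inj s : exponent_sequence s -> injective s.
Proof.
move=> hs i j /eqP; rewrite eq_le !(exponent_le hs) -eqn_leq => /eqP //.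
Qed.

Lemma exponent_unbounded s (c : R) : exponent_sequence s ->
  exists J, forall j, (J <= j)%N -> c < s j.
Proof.
case=> _ /cvgryPgt/(_ c)[J _ HJ] _ _; exists J => j Jj.
exact: HJ.
Qed.

Lemma unit_predP s k : exponent_sequence s ->
  match unit_pred s k with
  | Some i => s i + 1 = s k
  | None => forall i, s i + 1 != s k
  end.
Proof.
move=> hs; rewrite /unit_pred; case: pselect => [e|ne]; first exact: (projT2 (cid e)).
by move=> i; apply/eqP => h; apply: ne; exists i.
Qed.

Lemma unit_pred_lt s k i : exponent_sequence s -> unit_pred s k = Some i -> (i < k)%N.
Proof.
move=> hs hi; have := unit_predP k hs; rewrite hi => h.
by rewrite -(exponent_lt hs) -h ltrDl.
Qed.

(** Exponents of products are again admissible, so collecting terms only ever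
    produces powers that occur in the expansion. *)
Lemma range_sum s m (phi : 'I_m -> nat) : preserves_addition (range s) -> (0 < m)%N ->
  exists k, \sum_i s (phi i) = s k.
Proof.
move=> add_s; case: m phi => // m phi _; elim: m phi => [|m IH] phi.
  by exists (phi ord0); rewrite big_ord1.
rewrite big_ord_recl; have [k ->] := IH (fun i => phi (lift ord0 i)).
have [l _ <-] := add_s (s (phi ord0)) (s k) (ex_intro2 _ _ _ I erefl) (ex_intro2 _ _ _ I erefl).
by exists l.
Qed.

End Exponents.

(** A map whose value at [k] only depends on the values of its argument
    below [k] has a unique fixed point; iterating from any point stabilizes. *)
Lemma causal_fixpoint (X : Type) (x0 : X) (Phi : (nat -> X) -> nat -> X) :
  (forall q q' k, (forall i, (i < k)%N -> q i = q' i) -> Phi q k = Phi q' k) ->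
  exists q, (forall k, q k = Phi q k) /\
    forall q', (forall k, q' k = Phi q' k) -> q = q'.
Proof.
move=> causal.
pose q k := iter k.+1 Phi (fun=> x0) k.
have qE k n : (k < n)%N -> iter n Phi (fun=> x0) k = q k.
  elim/ltn_ind: k n => k IH [//|n]; rewrite ltnS => kn.
  rewrite /q !iterS; apply: causal => i ik.
  by rewrite !IH// (leq_trans ik).
have fq k : q k = Phi q k.
  by rewrite {1}/q iterS; apply: causal => i ik; rewrite qE.
exists q; split => // q' fq'; apply/funext => k.
elim/ltn_ind: k => k IH; rewrite fq fq'; exact: causal.
Qed.

Section MultiIndices.
Context {R : realType} (mu beta : nat -> R).
Hypotheses (hmu : exponent_sequence mu) (hbeta : exponent_sequence beta).
Hypotheses (hmu0 : 0 < mu 0%N) (hbeta0 : 0 <= beta 0%N).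

Lemma mu_gt0 k : 0 < mu k.
Proof. by rewrite (lt_le_trans hmu0)// (exponent_le hmu). Qed.

Lemma beta_ge0 k : 0 <= beta k.
Proof. by rewrite (le_trans hbeta0)// (exponent_le hbeta). Qed.

(** At least one further positive summand is present, since [2 <= m]. *)
Lemma multi_indices_mu k j m jl i : (2 <= m)%N -> multi_indices mu beta k j m jl ->
  (tnth jl.1 i < k)%N.
Proof.
move=> m2 [hm _]; rewrite -(exponent_lt hmu) -hm (bigD1 i)//= ltrDl.
have [i' i'i] : exists i' : 'I_m, i' != i.
  have m0 : (0 < m)%N by exact: ltn_trans m2.
  case: (eqVneq (Ordinal m0) i) => [k0|]; last by exists (Ordinal m0).
  by exists (Ordinal m2); rewrite -k0.
rewrite (bigD1 i')//= ltr_wpDr ?mu_gt0// sumr_ge0// => a _.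
exact/ltW/mu_gt0.
Qed.

Lemma multi_indices_beta k j m jl i : multi_indices mu beta k j m jl ->
  (tnth jl.2 i <= j)%N.
Proof.
move=> [_ hb]; rewrite -(exponent_le hbeta) -hb (bigD1 i)//= lerDl.
by rewrite sumr_ge0// => a _; exact: beta_ge0.
Qed.

Lemma multi_indices_degree k j m jl : multi_indices mu beta k j m jl ->
  m%:R * mu 0%N <= mu k.
Proof.
move=> [<- _]; rewrite mulr_natl -{1}(card_ord m) -sumr_const.
by apply: ler_sum => i _; rewrite (exponent_le hmu).
Qed.

(** Choosing one of [K * J] terms in each of the [m] factors of a product, as
    [multilinear_expand] does, is the same as choosing the two multi-indices. *)
Definition index_tuples m K J (phi : {ffun 'I_m -> 'I_K * 'I_J}) :
    m.-tuple nat * m.-tuple nat :=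
  ([tuple val (phi i).1 | i < m], [tuple val (phi i).2 | i < m]).

Lemma index_tuples_inj m K J : injective (@index_tuples m K J).
Proof.
move=> phi psi e; apply/ffunP => i.
have e1 := congr1 (fun u => tnth u.1 i) e; have e2 := congr1 (fun u => tnth u.2 i) e.
rewrite /= !tnth_mktuple in e1 e2.
by case: (phi i) (psi i) e1 e2 => [a b] [a' b'] /= /val_inj -> /val_inj ->.
Qed.

Definition index_sum_eq m K J (a b : R) (phi : {ffun 'I_m -> 'I_K * 'I_J}) : bool :=
  (\sum_i mu (phi i).1 == a) && (\sum_i beta (phi i).2 == b).

(** The link between the sums of the recursion, over all multi-indices, and
    those that come from expanding a product of finite sums. *)
Lemma multi_indices_sum (V : zmodType) m k j K J (F : m.-tuple nat * m.-tuple nat -> V) :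
  (forall jl i, multi_indices mu beta k j m jl ->
     (K <= tnth jl.1 i)%N || (J <= tnth jl.2 i)%N -> F jl = 0) ->
  \sum_(jl \in multi_indices mu beta k j m) F jl =
  \sum_(phi : {ffun 'I_m -> 'I_K * 'I_J} | index_sum_eq (mu k) (beta j) phi)
    F (index_tuples phi).
Proof.
move=> F0.
pose r := [seq index_tuples phi |
  phi <- index_enum {ffun 'I_m -> 'I_K * 'I_J} & index_sum_eq (mu k) (beta j) phi].
have rA jl : jl \in r -> multi_indices mu beta k j m jl.
  case/mapP => phi; rewrite mem_filter => /andP[/andP[/eqP h1 /eqP h2] _] ->.
  by split; [rewrite -h1|rewrite -h2]; apply: eq_bigr => i _; rewrite tnth_mktuple.
rewrite (fsbigE r)/=.
- rewrite big_seq_cond (eq_bigl (fun jl => jl \in r)); last first.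
    by move=> jl; case: (boolP (jl \in r)) => //= /rA h; rewrite mem_set.
  by rewrite -big_seq big_map big_filter.
- by rewrite map_inj_uniq ?filter_uniq ?index_enum_uniq//; exact: index_tuples_inj.
- exact: rA.
move=> jl hjl jlr.
have [h|] := pselect (exists i, (K <= tnth jl.1 i)%N || (J <= tnth jl.2 i)%N).
  by have [i hi] := h; exact: F0 hi.
move=> /forallNP h; exfalso; move/negP: jlr; apply.
have h1 i : (tnth jl.1 i < K)%N.
  by rewrite ltnNge; apply/negP => hi; apply: (h i); rewrite hi.
have h2 i : (tnth jl.2 i < J)%N.
  by rewrite ltnNge; apply/negP => hi; apply: (h i); rewrite hi orbT.
apply/mapP; exists [ffun i => (Ordinal (h1 i), Ordinal (h2 i))].
  rewrite mem_filter mem_index_enum andbT; case: hjl => e1 e2.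
  by apply/andP; split; apply/eqP; [rewrite -e1|rewrite -e2]; apply: eq_bigr => i _; rewrite ffunE.
case: jl {hjl h} h1 h2 => j1 j2 /= h1 h2.
by congr (_, _); apply: eq_from_tnth => i; rewrite tnth_mktuple ffunE.
Qed.

End MultiIndices.

Section Recursion.
Context {R : realType} {n : nat} (n_gt0 : (0 < n)%N).
Variables (A : 'M[R]_n) (cG : forall m, ('I_m -> 'cV[R]_n) -> 'cV[R]_n).
Variables (mu beta : nat -> R) (p : nat -> nat -> R -> 'cV[R]_n).
Arguments cG : clear implicits.
Hypotheses (Au : A \in unitmx).
Hypotheses (hmu : exponent_sequence mu) (hbeta : exponent_sequence beta).
Hypotheses (hmu0 : 0 < mu 0%N) (hbeta0 : 0 <= beta 0%N).
Hypothesis hcG : forall m, (2 <= m)%N -> multilinear_map (cG m).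
Hypothesis p_poly : forall k j, vector_poly (p k j).
Hypothesis p_fin : forall k, finite_set [set j | exists x, p k j x != 0].

Definition nonlinear_coef (q : nat -> nat -> R -> 'cV[R]_n) k j x : 'cV[R]_n :=
  \sum_(m \in [set m | (2 <= m)%N])
    \sum_(jl \in multi_indices mu beta k j m)
      cG m (fun i => q (tnth jl.1 i) (tnth jl.2 i) x).

Lemma nonlinear_coef_causal q q' k : (forall i, (i < k)%N -> q i = q' i) ->
  nonlinear_coef q k = nonlinear_coef q' k.
Proof.
move=> qq'; apply/funext => j; apply/funext => x; apply: eq_fsbigr => m.
rewrite inE => /= m2; apply: eq_fsbigr => jl; rewrite inE => hjl.
by apply: multilinear_ext => i; rewrite qq'// (multi_indices_mu hmu hmu0 _ m2 hjl).
Qed.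

Lemma chi_causal (q q' : nat -> nat -> R -> 'cV[R]_n) k :
  (forall i, (i < k)%N -> q i = q' i) -> chi mu beta q k = chi mu beta q' k.
Proof.
move=> qq'; apply/funext => j; apply/funext => x; rewrite /chi.
case E : (unit_pred mu k) => [la|//].
by rewrite qq'// (unit_pred_lt hmu E).
Qed.

Lemma nonlinear_coef0 q j x : nonlinear_coef q 0 j x = 0.
Proof.
apply: fsbig1 => m /= m2; apply: fsbig1 => jl hjl.
have m0 : (0 < m)%N by exact: ltn_trans m2.
by have := multi_indices_mu hmu hmu0 (Ordinal m0) m2 hjl.
Qed.

Lemma chi0 (q : nat -> nat -> R -> 'cV[R]_n) j x : chi mu beta q 0 j x = 0.
Proof.
by rewrite /chi; case E : (unit_pred mu 0) => [la|//]; have := unit_pred_lt hmu E.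
Qed.

(** The first step of the recursion is no exception: for [k = 0] there are no
    multi-indices and no predecessor, so both corrections vanish. *)
Lemma coefficient_recursionP q : coefficient_recursion A cG mu beta p q <->
  forall k j x, A *m q k j x =
    nonlinear_coef q k j x + p k j x + chi mu beta q k j x.
Proof.
have AK (u v : 'cV[R]_n) : u = invmx A *m v <-> A *m u = v.
  by split=> [->|<-]; [rewrite mulKVmx|rewrite mulKmx].
split=> [[q0 qS] [|k] j x|h]; first by apply/AK; rewrite nonlinear_coef0 chi0 add0r addr0.
  by apply/AK; exact: qS.
by split=> [j x|k j x _]; apply/AK; rewrite h// nonlinear_coef0 chi0 add0r addr0.
Qed.

Lemma coefficient_recursion_unique :
  exists q, unique (coefficient_recursion A cG mu beta p) q.
Proof.
pose Phi q k : nat -> R -> 'cV[R]_n := fun j x =>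
  invmx A *m (nonlinear_coef q k j x + p k j x + chi mu beta q k j x).
have fixP q : coefficient_recursion A cG mu beta p q <-> forall k, q k = Phi q k.
  split=> [/coefficient_recursionP h k|h].
    by apply/funext => j; apply/funext => x; rewrite /Phi -h mulKmx.
  by apply/coefficient_recursionP => k j x; rewrite {1}h mulKVmx.
have [|q [fq uq]] := @causal_fixpoint _ (fun _ _ => 0) Phi.
  move=> q q' k qq'; rewrite /Phi.
  by rewrite (nonlinear_coef_causal qq') (chi_causal qq').
by exists q; split; [exact/fixP|move=> q' /fixP; exact: uq].
Qed.

Variable q : nat -> nat -> R -> 'cV[R]_n.
Hypothesis hq : coefficient_recursion A cG mu beta p q.

(** The degree [m] is at most [mu k / mu 0], since each of the [m] summands
    of [mu k] is at least [mu 0]. *)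
Lemma nonlinear_coefE k j x K J M : (k <= K)%N -> mu k < M.+1%:R * mu 0%N ->
  (forall k' l, (k' < k)%N -> (l <= j)%N -> (J <= l)%N -> q k' l x = 0) ->
  nonlinear_coef q k j x = \sum_(m < M.+1 | (2 <= m)%N)
    \sum_(phi : {ffun 'I_m -> 'I_K * 'I_J} | index_sum_eq mu beta (mu k) (beta j) phi)
      cG m (fun i => q (phi i).1 (phi i).2 x).
Proof.
move=> kK kM qJ.
rewrite -(big_geq_mkord 2 M.+1 xpredT (fun m =>
  \sum_(phi : {ffun 'I_m -> 'I_K * 'I_J} | index_sum_eq mu beta (mu k) (beta j) phi)
    cG m (fun i => q (phi i).1 (phi i).2 x))).
rewrite /nonlinear_coef (fsbigE (index_iota 2 M.+1)).
- rewrite big_seq_cond [RHS]big_seq_cond; apply: eq_big => [m|m].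
    rewrite mem_index_iota; case: (ltnP m M.+1); rewrite !(andbT, andbF)//= => _.
    by case: (leqP 2 m) => //= m2; rewrite mem_set.
  rewrite mem_index_iota => /andP[/andP[m2 _] _].
  rewrite (multi_indices_sum (K := K) (J := J)).
    by apply: eq_bigr => phi _; apply: multilinear_ext => i; rewrite !tnth_mktuple.
  move=> jl i hjl; have h1 := multi_indices_mu hmu hmu0 i m2 hjl.
  rewrite leqNgt (leq_trans h1 kK)/= => Jl.
  apply: (multilinear_eq0 (hcG m2) (i := i)); apply: qJ => //.
  exact: (multi_indices_beta hbeta hbeta0 i hjl).
- exact: iota_uniq.
- by move=> m /=; rewrite mem_index_iota => /andP[].
move=> m /= m2; rewrite mem_index_iota m2/= -leqNgt => Mm.
apply: fsbig1 => jl hjl; have := multi_indices_degree hmu hjl.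
rewrite leNgt (lt_le_trans kM)// ler_wpM2r ?(ltW hmu0)// ler_nat//.
Qed.

Lemma degree_bound (c : R) : exists M, c < M.+1%:R * mu 0%N.
Proof.
exists (Num.truncn (c / mu 0%N)); rewrite -ltr_pdivrMr//.
exact: truncnS_gt.
Qed.

(** Only [q k' l] with [k' < k] and [l <= j] enter the formula for [q k j], and
    they enter through multilinear maps and a derivative. *)
Lemma coefficient_vector_poly k j : vector_poly (q k j).
Proof.
elim/ltn_ind: k j => k IH j.
have [M hM] := degree_bound (mu k).
have -> : q k j = fun x => invmx A *m (nonlinear_coef q k j x + p k j x + chi mu beta q k j x).
  by apply/funext => x; rewrite -(coefficient_recursionP q).1// mulKmx.
apply: vector_poly_mulmx; apply: vector_polyD; first apply: vector_polyD => //.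
  have -> : nonlinear_coef q k j = fun x => \sum_(m < M.+1 | (2 <= m)%N)
      \sum_(phi : {ffun 'I_m -> 'I_k * 'I_j.+1} | index_sum_eq mu beta (mu k) (beta j) phi)
        cG m (fun i => q (phi i).1 (phi i).2 x).
    apply/funext => x; apply: nonlinear_coefE => // k' l _ lj.
    by rewrite ltnNge lj.
  apply: vector_poly_sum => m m2; apply: vector_poly_sum => phi _.
  apply: vector_poly_multilinear => //; first exact: hcG.
  by move=> i; exact: IH.
rewrite /chi; case E : (unit_pred mu k) => [la|]; last exact: vector_poly_cst.
have la_lt := unit_pred_lt hmu E.
case: unit_pred => [l|]; last exact/vector_polyZ/IH.
apply: vector_polyD; last exact/vector_polyZ/IH.
apply: vector_polyD; first exact/vector_polyZ/IH.
under eq_fun do rewrite -scaleN1r; apply: vector_polyZ.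
by have [] := vector_poly_derive (IH la la_lt l).
Qed.

Lemma finite_set_bound (B : set nat) : finite_set B ->
  exists J, forall j, (J <= j)%N -> ~ B j.
Proof.
move=> /finite_seqP[s ->]; exists (\max_(i <- s) i).+1 => j sj /= js.
by move: sj; rewrite ltnNge leq_bigmax_seq.
Qed.

Lemma uniform_bound (P : nat -> nat -> Prop) k :
  (forall i, (i < k)%N -> exists J, forall j, (J <= j)%N -> P i j) ->
  exists J, forall i j, (i < k)%N -> (J <= j)%N -> P i j.
Proof.
move=> h; have /choice[J HJ] : forall i, exists J, (i < k)%N -> forall j, (J <= j)%N -> P i j.
  move=> i; case: (ltnP i k) => [ik|_]; last by exists 0%N.
  by have [J HJ] := h i ik; exists J.
exists (\max_(i < k) J i) => i j ik Jj; apply: HJ => //.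
by apply: leq_trans Jj; exact: (leq_bigmax (Ordinal ik)).
Qed.

(** If [q k' l = 0] for all [k' < k] and [l >= J0], a nonzero product has
    [beta j] at most [M * beta J0], where [M] bounds the degree, and a nonzero
    [chi] has [beta j] at most [beta J0 + 1]; both fail for large [j]. *)
Lemma coefficient_finite k : exists J, forall j, (J <= j)%N -> forall x, q k j x = 0.
Proof.
elim/ltn_ind: k => k IH.
have [J0 HJ0] := uniform_bound IH.
have [J1 HJ1] := finite_set_bound (p_fin k).
have [M hM] := degree_bound (mu k).
have [J2 HJ2] := exponent_unbounded (M%:R * beta J0) hbeta.
have [J3 HJ3] := exponent_unbounded (beta J0 + 1) hbeta.
exists (maxn (maxn J0 J1) (maxn J2 J3)) => j.
rewrite !geq_max => /andP[/andP[j0 j1] /andP[j2 j3]] x.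
suff : A *m q k j x = 0 by move=> /(congr1 (mulmx (invmx A))); rewrite mulKmx// mulmx0.
rewrite (coefficient_recursionP q).1//.
have -> : p k j x = 0.
  by apply/eqP/negP => /negP h; apply: (HJ1 j j1); exists x.
have -> : nonlinear_coef q k j x = 0.
  apply: fsbig1 => m /= m2; apply: fsbig1 => jl hjl.
  have [[i hi]|h] := pselect (exists i, (J0 <= tnth jl.2 i)%N).
    apply: (multilinear_eq0 (hcG m2) (i := i)); apply: HJ0 => //.
    exact: multi_indices_mu hjl.
  exfalso; have := HJ2 _ j2; have [_ <-] := hjl; apply/negP; rewrite -leNgt.
  apply: (@le_trans _ _ (\sum_(i < m) beta J0)).
    apply: ler_sum => i _; rewrite (exponent_le hbeta) leqNgt; apply/negP => hi.
    by apply: h; exists i; exact: ltnW.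
  have mM : (m <= M)%N.
    have := le_lt_trans (multi_indices_degree hmu hjl) hM.
    by rewrite ltr_pM2r// ltr_nat.
  rewrite sumr_const card_ord -[beta J0 *+ m]mulr_natl.
  apply: ler_wpM2r; first exact: (beta_ge0 hbeta hbeta0).
  by rewrite ler_nat.
rewrite !add0r /chi; case E : (unit_pred mu k) => [la|//].
have la_lt := unit_pred_lt hmu E.
rewrite HJ0// scaler0; have := unit_predP j hbeta; case: unit_pred => [l hl|//].
have J0l : (J0 <= l)%N.
  rewrite leqNgt; apply/negP => lJ0; have := HJ3 _ j3.
  by rewrite -hl ltrD2r (exponent_lt hbeta) ltnNge (ltnW lJ0).
have -> : q la l = cst 0 by apply/funext => y; exact: HJ0.
by rewrite derive1_cst /cst scaler0 subr0 addr0.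
Qed.

End Recursion.

(** * The truncated expansion solves the equation up to a small residual *)

Section Atoms.
Context {R : realType} {n : nat}.
Implicit Types (v w : R -> 'cV[R]_n) (a b t : R).

Definition atom a b v t : 'cV[R]_n :=
  t `^ (- a) *: (ln t `^ (- b) *: v (ln (ln t))).

Lemma atomD a b v w t : atom a b (fun x => v x + w x) t = atom a b v t + atom a b w t.
Proof. by rewrite /atom !scalerDr. Qed.

Lemma atom_sum a b (I : Type) (r : seq I) (P : pred I) (v : I -> R -> 'cV[R]_n) t :
  atom a b (fun x => \sum_(i <- r | P i) v i x) t = \sum_(i <- r | P i) atom a b (v i) t.
Proof. by rewrite /atom !scaler_sumr. Qed.

Lemma powO_atom nu a b v : nu < a -> vector_poly v -> powO (atom a b v) nu.
Proof.
move=> nua hv; apply: powO_slow => //; apply: slowZ; first exact: slow_ln_powR.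
exact: slow_vector_poly.
Qed.

(** The derivative is again a combination of atoms, with exponents raised by
    one; these two families produce the correction [chi]. *)
Lemma is_derive_atom a b v t : vector_poly v -> 1 < t ->
  is_derive t 1 (atom a b v)
    (- (atom (a + 1) b (fun x => a *: v x) t +
        atom (a + 1) (b + 1) (fun x => b *: v x - derive1 v x) t)).
Proof.
move=> hv t1; have t0 : 0 < t by exact: lt_trans t1.
have l0 : 0 < ln t by exact: ln_gt0.
have dl : is_derive t 1 (@ln R) t^-1 by exact: is_derive1_ln.
have dll : is_derive t 1 (fun s => ln (ln s)) ((ln t)^-1 * t^-1).
  exact: (is_derive1_comp (is_derive1_ln l0) dl).
have dlb : is_derive t 1 (fun s => ln s `^ (- b)) (- b * ln t `^ (- b - 1) * t^-1).
  exact: (is_derive1_comp (is_derive1_powR (- b) l0) dl).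
have dta := is_derive1_powR (- a) t0.
have [_ dv] := vector_poly_derive hv.
apply: is_derive_matrix => i j; rewrite (ord1 j).
have dvi := is_derive_entry i 0 (dv (ln (ln t))).
have dvll : is_derive t 1 (fun s => v (ln (ln s)) i 0)
    (derive1 v (ln (ln t)) i 0 * ((ln t)^-1 * t^-1)).
  exact: (@is_derive1_comp _ (fun s => v s i 0) (fun s => ln (ln s)) _ _ _ dvi dll).
have -> : (fun s => atom a b v s i 0) =
    (fun s => s `^ (- a)) * ((fun s => ln s `^ (- b)) * (fun s => v (ln (ln s)) i 0)).
  by apply/funext => s; rewrite /atom !mxE.
apply: (is_derive_eq (is_deriveM dta (is_deriveM dlb dvll))).
have Et c : t `^ (- (c + 1)) = t `^ (- c) * t^-1.
  by rewrite opprD powRB ?powRr1 ?(ltW t0)// (gt_eqF t0) implybT.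
have El c : ln t `^ (- (c + 1)) = ln t `^ (- c) * (ln t)^-1.
  by rewrite opprD powRB ?powRr1 ?(ltW l0)// (gt_eqF l0) implybT.
rewrite /atom !mxE -!opprD !Et !El.
rewrite /GRing.scale/=.
have -> : ((fun s : R => ln s `^ (- b)) * (fun s : R => v (ln (ln s)) i 0)) t =
  ln t `^ (- b) * v (ln (ln t)) i 0 by [].
by ring.
Qed.

Section Blocks.
Variables (mu beta : nat -> R).
Hypotheses (hmu : exponent_sequence mu) (hbeta : exponent_sequence beta).

(** For coefficients [c k j] that vanish for [J <= j], this is the truncated
    expansion. *)
Definition block N J (c : nat -> nat -> R -> 'cV[R]_n) t : 'cV[R]_n :=
  \sum_(k < N.+1) \sum_(j < J) atom (mu k) (beta j) (c k j) t.

Lemma blockD N J c d t :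
  block N J (fun k j x => c k j x + d k j x) t = block N J c t + block N J d t.
Proof.
rewrite /block -big_split; apply: eq_bigr => k _; rewrite -big_split.
by apply: eq_bigr => j _; exact: atomD.
Qed.

Lemma block_sum N J (I : Type) (r : seq I) (P : pred I) c t :
  block N J (fun k j x => \sum_(i <- r | P i) c i k j x) t =
  \sum_(i <- r | P i) block N J (c i) t.
Proof.
rewrite /block [RHS]exchange_big; apply: eq_bigr => k _.
rewrite [RHS]exchange_big; apply: eq_bigr => j _; exact: atom_sum.
Qed.

Lemma block_mulmx N J (A : 'M[R]_n) c t :
  block N J (fun k j x => A *m c k j x) t = A *m block N J c t.
Proof.
rewrite /block mulmx_sumr; apply: eq_bigr => k _.
rewrite mulmx_sumr; apply: eq_bigr => j _.
by rewrite /atom !scalemxAr.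
Qed.

Lemma block_ext N J c d t : (forall k j x, (k <= N)%N -> (j < J)%N -> c k j x = d k j x) ->
  block N J c t = block N J d t.
Proof.
move=> cd; apply: eq_bigr => k _; apply: eq_bigr => j _.
by rewrite /atom cd// -ltnS.
Qed.

(** Collecting equal exponents: a term whose power of [t] is not among
    [mu 0, .., mu N] is, up to a slowly varying factor, at most of the order
    [t `^ (- mu N.+1)]. *)
Lemma regroup N nu (I : finType) (P : pred I) (a b : I -> R) (v : I -> R -> 'cV[R]_n) :
  nu < mu N.+1 ->
  (forall i, P i -> exists k, a i = mu k) -> (forall i, P i -> exists j, b i = beta j) ->
  (forall i, P i -> vector_poly (v i)) ->
  exists J0, forall J, (J0 <= J)%N ->
    powO (fun t => \sum_(i | P i) atom (a i) (b i) (v i) t -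
      block N J (fun k j x => \sum_(i | P i && ((a i == mu k) && (b i == beta j))) v i x) t) nu.
Proof.
move=> nuN amu bbeta vpoly.
have /choice[K HK] : forall i, exists k, P i -> a i = mu k.
  by move=> i; case Pi : (P i); [have [k ->] := amu i Pi; exists k|exists 0%N].
have /choice[L HL] : forall i, exists j, P i -> b i = beta j.
  by move=> i; case Pi : (P i); [have [k ->] := bbeta i Pi; exists k|exists 0%N].
exists (\max_i L i).+1 => J LJ.
have LiJ i : (L i < J)%N by apply: leq_trans LJ; rewrite ltnS leq_bigmax.
have E t : block N J (fun k j x => \sum_(i | P i && ((a i == mu k) && (b i == beta j))) v i x) t =
    \sum_(i | P i) if (K i <= N)%N then atom (a i) (b i) (v i) t else 0.
  transitivity (\sum_(k < N.+1) \sum_(j < J) \sum_(i | P i)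
      if (K i == k) && (L i == j) then atom (a i) (b i) (v i) t else 0).
    apply: eq_bigr => k _; apply: eq_bigr => j _.
    rewrite atom_sum big_mkcondr; apply: eq_bigr => i Pi.
    rewrite (HK i Pi) (HL i Pi) (inj_eq (exponent_inj hmu)) (inj_eq (exponent_inj hbeta)).
    by case: ifP => // /andP[/eqP <- /eqP <-].
  under eq_bigr do rewrite exchange_big.
  rewrite exchange_big; apply: eq_bigr => i Pi.
  case: (leqP (K i) N) => KN; last first.
    rewrite big1// => k _; rewrite big1// => j _.
    by case: eqP => // Kk; move: KN; rewrite Kk ltnNge -ltnS ltn_ord.
  have KN' : (K i < N.+1)%N by [].
  rewrite (bigD1 (Ordinal KN'))//= [X in _ + X]big1 ?addr0; last first.
    move=> k /eqP kK; rewrite big1// => j _; case: eqP => // Kk.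
    by case: kK; apply/val_inj.
  rewrite (bigD1 (Ordinal (LiJ i)))//= !eqxx/= big1 ?addr0// => j /eqP jL.
  by case: eqP => // Lj; case: jL; apply/val_inj.
apply: (@powO_near _ _ _ (fun t =>
  \sum_(i | P i) if (K i <= N)%N then 0 else atom (a i) (b i) (v i) t)).
  near=> t; rewrite E -sumrB; apply: eq_bigr => i _.
  by case: ifP; rewrite ?subrr ?subr0.
apply: powO_sum => i Pi; case: leqP => KN; first exact: powO0.
apply: powO_atom; last exact: vpoly.
by rewrite (HK i Pi) (lt_le_trans nuN)// (exponent_le hmu).
Unshelve. all: by end_near. Qed.

End Blocks.
End Atoms.

Section Residual.
Context {R : realType} {n : nat} (n_gt0 : (0 < n)%N).
Variables (A : 'M[R]_n) (cG : forall m, ('I_m -> 'cV[R]_n) -> 'cV[R]_n).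
Variables (mu beta : nat -> R) (p q : nat -> nat -> R -> 'cV[R]_n).
Arguments cG : clear implicits.
Hypotheses (Au : A \in unitmx).
Hypotheses (hmu : exponent_sequence mu) (hbeta : exponent_sequence beta).
Hypotheses (hmu0 : 0 < mu 0%N) (hbeta0 : 0 <= beta 0%N).
Hypothesis hcG : forall m, (2 <= m)%N -> multilinear_map (cG m).
Hypothesis q_poly : forall k j, vector_poly (q k j).
Hypothesis hq : coefficient_recursion A cG mu beta p q.
Variables (N J0 : nat).
Hypothesis p_fin : forall k j, (k <= N)%N -> (J0 <= j)%N -> forall x, p k j x = 0.
Hypothesis q_fin : forall k j, (k <= N)%N -> (J0 <= j)%N -> forall x, q k j x = 0.

Let Idx := ('I_N.+1 * 'I_J0)%type.

Lemma block_pair (c : nat -> nat -> R -> 'cV[R]_n) t :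
  block mu beta N J0 c t = \sum_(i : Idx) atom (mu i.1) (beta i.2) (c i.1 i.2) t.
Proof. by rewrite /block pair_big. Qed.

Lemma block_widen J (c : nat -> nat -> R -> 'cV[R]_n) t : (J0 <= J)%N ->
  (forall k j, (k <= N)%N -> (J0 <= j)%N -> forall x, c k j x = 0) ->
  block mu beta N J c t = block mu beta N J0 c t.
Proof.
move=> J0J c0; apply: eq_bigr => k _.
rewrite [RHS](big_ord_widen J (fun j => atom (mu k) (beta j) (c k j) t))// [RHS]big_mkcond/=.
apply: eq_bigr => j _; case: ltnP => // Jj.
by rewrite /atom c0 ?scaler0// -ltnS.
Qed.

Lemma sum_pair_single (F : nat -> nat -> 'cV[R]_n) la l :
  (la <= N)%N -> ((J0 <= l)%N -> F la l = 0) ->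
  \sum_(i : Idx | (i.1 == la :> nat) && (i.2 == l :> nat)) F i.1 i.2 = F la l.
Proof.
move=> laN F0; case: (ltnP l J0) => lJ; last first.
  rewrite F0// big1// => -[[k kN] [j jJ]] /= /andP[_ /eqP jl].
  by move: jJ; rewrite jl ltnNge lJ.
have laN' : (la < N.+1)%N by [].
by rewrite (big_pred1 (Ordinal laN', Ordinal lJ)).
Qed.

(** The contributions to [- S'] of the powers of [t], collected by exponents;
    those of the logarithmic factors are in [log_drift]. *)
Definition drift (k j : nat) (x : R) : 'cV[R]_n :=
  \sum_(i : Idx | (mu i.1 + 1 == mu k) && (beta i.2 == beta j)) mu i.1 *: q i.1 i.2 x.

Definition log_drift (k j : nat) (x : R) : 'cV[R]_n :=
  \sum_(i : Idx | (mu i.1 + 1 == mu k) && (beta i.2 + 1 == beta j))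
     (beta i.2 *: q i.1 i.2 x - derive1 (q i.1 i.2) x).

Lemma drift_chi k j x : (k <= N)%N ->
  drift k j x + log_drift k j x = chi mu beta q k j x.
Proof.
move=> kN; rewrite /chi /drift /log_drift.
have := unit_predP k hmu; case E : (unit_pred mu k) => [la|] hla; last first.
  by rewrite !big_pred0 ?addr0// => i; rewrite (negbTE (hla _)).
have laN : (la <= N)%N by rewrite ltnW// (leq_trans (unit_pred_lt hmu E)).
have muE i : (mu i + 1 == mu k) = (i == la).
  by rewrite -hla (inj_eq (addIr _)) (inj_eq (exponent_inj hmu)).
have -> : \sum_(i : Idx | (mu i.1 + 1 == mu k) && (beta i.2 == beta j)) mu i.1 *: q i.1 i.2 x
    = mu la *: q la j x.
  rewrite -(sum_pair_single (F := fun k j => mu k *: q k j x) laN).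
    by apply: eq_bigl => i; rewrite muE (inj_eq (exponent_inj hbeta)).
  by move=> Jj; rewrite q_fin// scaler0.
have := unit_predP j hbeta; case: unit_pred => [l|] hl; last first.
  by rewrite big_pred0 ?addr0// => i; rewrite (negbTE (hl _)) andbF.
rewrite -addrA [- _ + _]addrC; congr (_ + _).
rewrite -(sum_pair_single (F := fun k j => beta j *: q k j x - derive1 (q k j) x) laN).
  apply: eq_bigl => i; rewrite muE -hl (inj_eq (addIr _)).
  by rewrite (inj_eq (exponent_inj hbeta)).
move=> Jl; have -> : q la l = cst 0 by apply/funext => y; rewrite q_fin.
by rewrite derive1_cst /cst scaler0 subr0.
Qed.

Definition block_derive t : 'cV[R]_n :=
  - (\sum_(i : Idx) atom (mu i.1 + 1) (beta i.2) (fun x => mu i.1 *: q i.1 i.2 x) t +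
     \sum_(i : Idx) atom (mu i.1 + 1) (beta i.2 + 1)
       (fun x => beta i.2 *: q i.1 i.2 x - derive1 (q i.1 i.2) x) t).

Lemma is_derive_big_fun (T : Type) (r : seq T) (F : T -> R -> 'cV[R]_n) dF (t : R) :
  (forall i, is_derive t 1 (F i) (dF i)) ->
  is_derive t 1 (fun s => \sum_(i <- r) F i s) (\sum_(i <- r) dF i).
Proof.
move=> h; elim: r => [|i r IH].
  by under eq_fun do rewrite big_nil; rewrite big_nil; exact: is_derive_cst.
under eq_fun do rewrite big_cons; rewrite big_cons.
exact: is_deriveD.
Qed.

Lemma is_derive_block (t : R) : 1 < t ->
  is_derive t 1 (block mu beta N J0 q) (block_derive t).
Proof.
move=> t1.
have -> : block mu beta N J0 q = fun t => \sum_(i : Idx) atom (mu i.1) (beta i.2) (q i.1 i.2) t.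
  by apply/funext => s; exact: block_pair.
have := @is_derive_big_fun _ (index_enum _) _ _ t
  (fun i : Idx => is_derive_atom (mu i.1) (beta i.2) (q_poly i.1 i.2) t1).
by move=> h; apply: (is_derive_eq h); rewrite /block_derive sumrN big_split.
Qed.

Lemma powR_sum (T : Type) (r : seq T) (a : T -> R) (t : R) : 0 < t ->
  \prod_(i <- r) t `^ (- a i) = t `^ (- \sum_(i <- r) a i).
Proof.
move=> t0; elim: r => [|i r IH]; first by rewrite !big_nil oppr0 powRr0.
by rewrite !big_cons IH opprD powRD// (gt_eqF t0) implybT.
Qed.

(** Exponents add up in a product of atoms. *)
Lemma multilinear_block m (t : R) : (2 <= m)%N -> 1 < t -> (0 < J0)%N ->
  cG m (fun=> block mu beta N J0 q t) =
  \sum_(phi : {ffun 'I_m -> 'I_N.+1 * 'I_J0})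
     atom (\sum_i mu (phi i).1) (\sum_i beta (phi i).2)
       (fun x => cG m (fun i => q (phi i).1 (phi i).2 x)) t.
Proof.
move=> m2 t1 J0_gt0; have t0 : 0 < t by exact: lt_trans t1.
have l0 : 0 < ln t by exact: ln_gt0.
have hm := hcG m2.
transitivity (cG m (fun _ => \sum_(i : Idx) atom (mu i.1) (beta i.2) (q i.1 i.2) t)).
  by apply: multilinear_ext => i; exact: block_pair.
rewrite (multilinear_expand hm (ord0, Ordinal J0_gt0)); apply: eq_bigr => phi _.
rewrite (multilinear_scale hm (fun i => t `^ (- mu (phi i).1))).
rewrite (multilinear_scale hm (fun i => ln t `^ (- beta (phi i).2))).
by rewrite /atom !powR_sum.
Qed.

(** Once like powers of [t] and of [ln t] are collected, the coefficient of
    each of the powers [mu 0, .., mu N] is an instance of the recursion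
    equation for [q], so only higher powers of [1 / t] remain. *)
Lemma residual nu M : nu < mu N.+1 -> mu N < M.+1%:R * mu 0%N -> (0 < J0)%N ->
  powO (fun t => block mu beta N J0 p t - A *m block mu beta N J0 q t
    + \sum_(m < M.+1 | (2 <= m)%N) cG m (fun=> block mu beta N J0 q t)
    - block_derive t) nu.
Proof.
move=> nuN hM J0_gt0.
have [_ _ mu_add mu_inc] := hmu; have [_ _ beta_add beta_inc] := hbeta.
have mu_incE k : exists k', mu k + 1 = mu k'.
  by have [k' _ <-] := mu_inc (mu k) (ex_intro2 _ _ k I erefl); exists k'.
have beta_incE k : exists k', beta k + 1 = beta k'.
  by have [k' _ <-] := beta_inc (beta k) (ex_intro2 _ _ k I erefl); exists k'.
pose nl m (phi : {ffun 'I_m -> 'I_N.+1 * 'I_J0}) x := cG m (fun i => q (phi i).1 (phi i).2 x).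
pose C m k j x := \sum_(phi : {ffun 'I_m -> 'I_N.+1 * 'I_J0} |
  index_sum_eq mu beta (mu k) (beta j) phi) nl m phi x.
have [J1 HJ1] := regroup (N := N) (P := xpredT) (a := fun i : Idx => mu i.1 + 1)
  (b := fun i : Idx => beta i.2) (v := fun (i : Idx) x => mu i.1 *: q i.1 i.2 x) hmu hbeta nuN
  (fun i _ => mu_incE i.1) (fun i _ => ex_intro _ (i.2 : nat) erefl)
  (fun i _ => vector_polyZ (mu i.1) (q_poly i.1 i.2)).
have log_poly (i : Idx) : vector_poly (fun x => beta i.2 *: q i.1 i.2 x - derive1 (q i.1 i.2) x).
  apply: vector_polyD; first exact: vector_polyZ.
  under eq_fun do rewrite -scaleN1r; apply: vector_polyZ.
  by have [] := vector_poly_derive (q_poly i.1 i.2).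
have [J2 HJ2] := regroup (N := N) (P := xpredT) (a := fun i : Idx => mu i.1 + 1)
  (b := fun i : Idx => beta i.2 + 1) hmu hbeta nuN
  (fun i _ => mu_incE i.1) (fun i _ => beta_incE i.2) (fun i _ => log_poly i).
have [J3 HJ3] : exists J3, forall m J, (m < M.+1)%N -> (J3 <= J)%N -> (2 <= m)%N ->
    powO (fun t => cG m (fun=> block mu beta N J0 q t) - block mu beta N J (C m) t) nu.
  apply: uniform_bound => m mM; case: (leqP 2 m) => m2; last by exists 0%N.
  have m0 : (0 < m)%N by exact: ltn_trans m2.
  have [J3 HJ3] := regroup (N := N) (P := xpredT)
    (a := fun phi : {ffun 'I_m -> 'I_N.+1 * 'I_J0} => \sum_i mu (phi i).1)
    (b := fun phi : {ffun 'I_m -> 'I_N.+1 * 'I_J0} => \sum_i beta (phi i).2)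
    (v := nl m) hmu hbeta nuN
    (fun phi _ => range_sum (fun i => (phi i).1 : nat) mu_add m0)
    (fun phi _ => range_sum (fun i => (phi i).2 : nat) beta_add m0)
    (fun phi _ => vector_poly_multilinear n_gt0 (hcG m2) (fun i => q_poly (phi i).1 (phi i).2)).
  exists J3 => J JJ _; apply: powO_near (HJ3 J JJ); near=> t.
  by rewrite multilinear_block//; near: t; exact: nbhs_pinfty_gt.
pose J := maxn J0 (maxn J1 (maxn J2 J3)).
have [J0J [J1J [J2J J3J]]] : (J0 <= J)%N /\ (J1 <= J)%N /\ (J2 <= J)%N /\ (J3 <= J)%N.
  by rewrite /J !leq_max !leqnn !orbT.
have h := powOD (powOD (powO_sum (P := fun m : 'I_M.+1 => (2 <= m)%N) (index_enum _)
   (fun (m : 'I_M.+1) m2 => HJ3 m J (ltn_ord m) J3J m2)) (HJ1 J J1J)) (HJ2 J J2J).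
apply: powO_near h; near=> t.
have E : A *m block mu beta N J0 q t = block mu beta N J0 p t +
    (\sum_(m < M.+1 | (2 <= m)%N) block mu beta N J (C m) t +
     (block mu beta N J drift t + block mu beta N J log_drift t)).
  rewrite -(block_widen t J0J q_fin) -(block_widen t J0J p_fin).
  rewrite -block_mulmx -(block_sum mu beta N J _ _ (fun m : 'I_M.+1 => C m)) -!blockD.
  apply: block_ext => k j x kN _.
  rewrite (coefficient_recursionP cG beta p Au hmu hmu0 q).1// drift_chi// addrA.
  congr (_ + _); rewrite [RHS]addrC; congr (_ + _).
  apply: (nonlinear_coefE hmu hbeta hmu0 hbeta0 hcG) => //.
  - by rewrite (leq_trans kN).
  - by rewrite (le_lt_trans _ hM)// (exponent_le hmu).
  move=> k' l k'k _ Jl; apply: q_fin => //.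
  by rewrite ltnW// (leq_trans k'k).
rewrite sumrB E /block_derive; apply/matrixP => i j.
set a := block _ _ _ _ p t; set b := \sum_(m < _ | _) block _ _ _ _ _ _.
set c := block _ _ _ _ drift t; set d := block _ _ _ _ log_drift t.
set e := \sum_(m < _ | _) _; set f := \sum_i _; set g := \sum_i _.
move: a b c d e f g => a b c d e f g; rewrite !mxE; ring.
Unshelve. all: by end_near. Qed.

End Residual.

(** * Decay of the remainder *)

Section Remainder.
Context {R : realType} {n : nat}.

Lemma diagonalizable_unit (A : 'M[R]_n) : diagonalizable_pos A -> A \in unitmx.
Proof.
move=> [S [d [Su dpos ->]]]; rewrite !unitmx_mul unitmx_inv Su andbT/=.
rewrite unitmxE det_diag unitfE; apply/prodf_neq0 => i _.
by rewrite gt_eqF.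
Qed.

Lemma bigO_at_inftyP (g : R -> 'cV[R]_n) nu :
  bigO_at_infty g (fun t => t `^ (- nu)) <-> powO g nu.
Proof.
split=> [[T [C [T0 C0 H]]]|/powO_ge0[C C0 [M [Mr HM]]]].
  exists C; near=> t; apply: (le_trans (norm_le_enorm _)); apply: H.
  by near: t; apply: nbhs_pinfty_ge; exact: num_real.
exists (Num.max 1 (M + 1)), ((n%:R + 1) * C); split.
- by rewrite lt_max ltr01.
- by rewrite mulr_gt0// ltr_wpDl.
move=> t; rewrite ge_max => /andP[t1 Mt].
apply: (le_trans (enorm_le_norm _)); rewrite -mulrA.
have h : `|g t| <= C * t `^ (- nu) by apply: HM; rewrite (lt_le_trans _ Mt)// ltrDl.
by rewrite ler_pM// lerDl.
Unshelve. all: by end_near. Qed.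

Lemma powOX (g : R -> R) a k : powO g a -> powO (fun t => g t ^+ k) (k%:R * a).
Proof.
move=> ga; elim: k => [|k IH].
  by rewrite mul0r; apply: powO_near (powO_cst (1 : R)); near=> t; rewrite expr0.
have := powOZ ga IH; rewrite -natr1 mulrDl mul1r addrC.
by apply: powO_near; near=> t; rewrite exprS.
Unshelve. all: by end_near. Qed.

Lemma powO_block (mu beta : nat -> R) N J c nu : exponent_sequence mu ->
  nu < mu 0%N -> (forall k j, vector_poly (c k j)) ->
  powO (block (n := n) mu beta N J c) nu.
Proof.
move=> hmu nu0 hc; apply: powO_sum => k _; apply: powO_sum => j _.
by apply: powO_atom => //; rewrite (lt_le_trans nu0)// (exponent_le hmu).
Qed.

Lemma expansion_block (mu beta : nat -> R) N J (c : nat -> nat -> R -> 'cV[R]_n) t :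
  (forall k j, (k <= N)%N -> (J <= j)%N -> forall x, c k j x = 0) ->
  \sum_(k < N.+1) t `^ (- mu k) *:
     \sum_(j \in [set: nat]) ln t `^ (- beta j) *: c k j (ln (ln t)) =
  block mu beta N J c t.
Proof.
move=> c0; apply: eq_bigr => k _; rewrite -scaler_sumr; congr (_ *: _).
rewrite (fsbigE (index_iota 0 J)) ?iota_uniq//=.
  by rewrite big_mkord; apply: eq_bigl => j; rewrite in_setT.
by move=> j _; rewrite mem_index_iota/= -leqNgt => Jj; rewrite c0 ?scaler0// -ltnS.
Qed.

Section Taylor.
Variables (n_gt0 : (0 < n)%N) (G : 'cV[R]_n -> 'cV[R]_n) (Gm : nat -> 'cV[R]_n -> 'cV[R]_n).
Variable cG : forall m, ('I_m -> 'cV[R]_n) -> 'cV[R]_n.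
Arguments cG : clear implicits.
Hypothesis hG : homogeneous_expansion G Gm.
Hypothesis hcG : forall m, (2 <= m)%N -> multilinear_map (cG m).
Hypothesis hcGm : forall m v, (2 <= m)%N -> Gm m v = cG m (fun=> v).

Definition taylor M (v : 'cV[R]_n) : 'cV[R]_n :=
  \sum_(m < M.+1 | (2 <= m)%N) cG m (fun=> v).

Lemma taylor0 M : taylor M 0 = 0.
Proof.
rewrite /taylor big1// => m m2.
by apply: (multilinear_eq0 (hcG m2) (i := Ordinal (ltn_trans (ltn0Sn 0) m2))).
Qed.

Lemma taylor_lipschitz M : exists2 K : R, 0 < K &
  forall (y z : 'cV[R]_n) (r : R), 0 <= r -> r <= 1 -> `|y| <= r -> `|z| <= r ->
    `|taylor M y - taylor M z| <= K * r * `|y - z|.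
Proof.
elim: M => [|M [K K0 HK]].
  exists 1 => // y z r r0 _ _ _; rewrite /taylor big_mkcond big_ord1.
  by rewrite big_mkcond big_ord1 subrr normr0 !mulr_ge0.
have TE v : taylor M.+1 v = taylor M v + if (2 <= M.+1)%N then cG M.+1 (fun=> v) else 0.
  by rewrite /taylor big_mkcond big_ord_recr -big_mkcond.
case: (leqP 2 M.+1) TE => M2 TE; last first.
  by exists K => // y z r r0 r1 yr zr; rewrite !TE !addr0; exact: HK.
have [L L0 HL] := multilinear_lipschitz (hcG M2) n_gt0 M2.
exists (K + L); first exact: addr_gt0.
move=> y z r r0 r1 yr zr; rewrite !TE opprD addrACA (le_trans (ler_normD _ _))//.
by rewrite !mulrDl lerD//; [exact: HK|exact: HL].
Qed.

Lemma taylor_remainder M : (2 <= M)%N -> exists r C : R, [/\ 0 < r, 0 < C &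
  forall v, `|v| < r -> `|G v - taylor M v| <= C * `|v| ^+ M].
Proof.
move=> M2; have [d d0 [r [C [r0 C0 H]]]] := hG.2 M M2.
have n0 : 0 < n%:R :> R by rewrite ltr0n.
exists (Num.min 1 (r / n%:R)), (C * n%:R `^ (M%:R + d)); split.
- by rewrite lt_min ltr01 divr_gt0.
- by rewrite mulr_gt0// powR_gt0.
move=> v; rewrite lt_min ltr_pdivlMr// => /andP[v1 vr].
have er : enorm v < r by rewrite (le_lt_trans (enorm_le_norm v))// mulrC.
have -> : taylor M v = \sum_(2 <= m < M.+1) Gm m v.
  by rewrite big_geq_mkord; apply: eq_bigr => m m2; rewrite hcGm.
apply: (le_trans (norm_le_enorm _)); apply: (le_trans (H v er)).
rewrite -mulrA ler_wpM2l ?(ltW C0)//.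
apply: (@le_trans _ _ ((n%:R * `|v|) `^ (M%:R + d))).
  rewrite ge0_ler_powR ?nnegrE ?enorm_ge0 ?mulr_ge0 ?enorm_le_norm//.
  by rewrite addr_ge0// ltW.
rewrite powRM ?(ltW n0)// ler_wpM2l ?powR_ge0// -powR_mulrn//.
have [->|v0] := eqVneq v 0.
  rewrite normr0 !powR0 ?gt_eqF ?addr_gt0 ?ltr0n//; exact: ltn_trans M2.
by rewrite ger_powR ?normr_gt0 ?v0 ?(ltW v1)// lerDl ltW.
Qed.

End Taylor.
End Remainder.

Section Solution.
Context {R : realType} {n : nat}.
Variables (n_gt0 : (0 < n)%N) (A : 'M[R]_n) (hA : diagonalizable_pos A).
Variables (G : 'cV[R]_n -> 'cV[R]_n) (Gm : nat -> 'cV[R]_n -> 'cV[R]_n).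
Variable cG : forall m, ('I_m -> 'cV[R]_n) -> 'cV[R]_n.
Arguments cG : clear implicits.
Hypothesis hG : homogeneous_expansion G Gm.
Hypothesis hcG : forall m, (2 <= m)%N -> multilinear_map (cG m).
Hypothesis hcGm : forall m v, (2 <= m)%N -> Gm m v = cG m (fun=> v).
Variables (f y : R -> 'cV[R]_n).
Hypothesis hy : \forall t \near +oo,
  is_derive (t : R) 1 y (- (A *m y t) + G (y t) + f t).
Hypothesis hy0 : y t @[t --> +oo] --> (0 : 'cV[R]_n).

Let T := taylor cG.

Lemma solution_small (r : R) : 0 < r -> \forall t \near +oo, `|y t| < r.
Proof.
by move=> r0; move/cvgr0Pnorm_lt : hy0 => /(_ _ r0).
Qed.

(** The nonlinearity is [o(|y|)], hence absorbed by the linear part. *)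
Lemma solution_decay nu : 0 <= nu -> powO f nu -> powO y nu.
Proof.
move=> nu0 [C hf]; have [e e0 He] := linear_decay hA.
have [r [D [r0 D0 HD]]] := taylor_remainder n_gt0 hG hcGm (leqnn 2).
have [K K0 HK] := taylor_lipschitz n_gt0 hcG 2.
have KD0 : 0 < K + D by exact: addr_gt0.
apply: (He y (fun t => G (y t) + f t) nu C) => //.
  by apply: filterS hy => t; rewrite addrA.
near=> t; rewrite (le_trans (ler_normD _ _))// lerD//; last by near: t.
have y1 : `|y t| < 1 by near: t; exact: solution_small.
have yr : `|y t| < r by near: t; exact: solution_small.
have ye : `|y t| < e / (K + D) by near: t; apply: solution_small; exact: divr_gt0.
rewrite -[G (y t)](subrK (T 2 (y t))).
apply: (@le_trans _ _ ((K + D) * `|y t| * `|y t|)); last first.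
  by rewrite ler_wpM2r// mulrC -ler_pdivlMr// ltW.
rewrite addrC !mulrDl (le_trans (ler_normD _ _))// lerD//; last first.
  by have := HD _ yr; rewrite expr2 mulrA.
have := HK (y t) 0 `|y t| (normr_ge0 _) (ltW y1) (lexx _).
by rewrite normr0 normr_ge0 taylor0// !subr0; apply.
Unshelve. all: by end_near. Qed.

(** If [S] is a small approximate solution, then [y - S] solves the linear
    equation up to the residual and a small multiple of itself. *)
Lemma approximation_decay M (S dS P : R -> 'cV[R]_n) a nu :
  0 < a -> 0 <= nu -> (2 <= M)%N -> nu <= M%:R * a -> powO y a -> powO S a ->
  (\forall t \near +oo, is_derive (t : R) 1 S (dS t)) ->
  powO (fun t => f t - P t) nu ->
  powO (fun t => P t - A *m S t + T M (S t) - dS t) nu ->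
  powO (fun t => y t - S t) nu.
Proof.
move=> a0 nu0 M2 nuM ya Sa dSP fP res; have [e e0 He] := linear_decay hA.
have [r [D [r0 D0 HD]]] := taylor_remainder n_gt0 hG hcGm M2.
have [K K0 HK] := taylor_lipschitz n_gt0 hcG M.
have remy : powO (fun t => G (y t) - T M (y t)) nu.
  have ya' : powO (fun t => `|y t|) a by apply: powO_le ya; near=> t; rewrite normr_id.
  have := powO_weak nuM (powOX M ya') => yM.
  have := powOZ (powO_cst D) yM; rewrite add0r; apply: powO_le.
  near=> t; rewrite [leRHS]ger0_norm ?mulr_ge0 ?exprn_ge0 ?(ltW D0)//.
  by apply: HD; near: t; exact: solution_small.
have [C HC] := powOD remy (powOD fP res).
apply: (He (fun t => y t - S t) (fun t => G (y t) + f t - A *m S t - dS t) nu C) => //.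
  near=> t.
  have h1 : is_derive t 1 y (- (A *m y t) + G (y t) + f t) by near: t.
  have h2 : is_derive t 1 S (dS t) by near: t.
  apply: (is_derive_eq (is_deriveB h1 h2)).
  rewrite mulmxBr; apply/matrixP => i j.
  move: (A *m y t) (A *m S t) (G (y t)) (f t) (dS t) => u1 u2 u3 u4 u5.
  by rewrite !mxE; ring.
pose s := Num.min 1 (e / K).
have s0 : 0 < s by rewrite lt_min ltr01 divr_gt0.
near=> t.
have -> : G (y t) + f t - A *m S t - dS t = (T M (y t) - T M (S t)) +
   (G (y t) - T M (y t) + (f t - P t + (P t - A *m S t + T M (S t) - dS t))).
  apply/matrixP => i j.
  move: (A *m S t) (T M (y t)) (T M (S t)) (G (y t)) => u1 u2 u3 u4.
  move: (f t) (dS t) (P t) => u5 u6 u7.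
  by rewrite !mxE; ring.
rewrite (le_trans (ler_normD _ _))// lerD//; last by near: t.
have h := HK (y t) (S t) s (ltW s0).
apply: (@le_trans _ _ (K * s * `|y t - S t|)).
  apply: h; first by rewrite ge_min lexx.
    by rewrite ltW//; near: t; exact: solution_small.
  by near: t; exact: (powO_cvg0 a0 Sa).
by rewrite ler_wpM2r// mulrC -ler_pdivlMr// ge_min lexx orbT.
Unshelve. all: by end_near. Qed.

End Solution.

Theorem corollary5p11 (R : realType) (n : nat) (hn : (0 < n)%N)
  (A : 'M[R]_n) (hA : diagonalizable_pos A)
  (G : 'cV[R]_n -> 'cV[R]_n) (hGlip : locally_lipschitz G)
  (Gm : nat -> 'cV[R]_n -> 'cV[R]_n) (hG : homogeneous_expansion G Gm)
  (cG : forall m : nat, ('I_m -> 'cV[R]_n) -> 'cV[R]_n)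
  (hcG : forall m : nat, (2 <= m)%N -> multilinear_map (@cG m))
  (hcGm : forall (m : nat) (v : 'cV[R]_n), (2 <= m)%N ->
    Gm m v = cG m (fun=> v))
  (f : R -> 'cV[R]_n)
  (mu beta : nat -> R)
  (hmu : exponent_sequence mu) (hbeta : exponent_sequence beta)
  (hmu0 : 0 < mu 0%N) (hbeta0 : 0 <= beta 0%N)
  (hf : exists2 Tf : R, 0 <= Tf & {within `[Tf, +oo[, continuous f})
  (p : nat -> nat -> R -> 'cV[R]_n)
  (hfp : log_power_expansion mu beta f p)
  (T0 : R) (hT0 : 0 <= T0)
  (y : R -> 'cV[R]_n)
  (hy : forall t : R, T0 < t -> is_derive t 1 y (- (A *m y t) + G (y t) + f t))
  (hyC1 : forall t : R, T0 < t -> {for t, continuous (derive1 y)})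
  (hy0 : y t @[t --> +oo] --> (0 : 'cV[R]_n)) :
  exists q : nat -> nat -> R -> 'cV[R]_n,
    unique (coefficient_recursion A cG mu beta p) q /\
    log_power_expansion mu beta y q.
Proof.
have Au := diagonalizable_unit hA.
have [p_poly p_fin f_exp] := hfp.
have [q [hq uq]] := coefficient_recursion_unique cG beta p Au hmu hmu0.
have q_poly := coefficient_vector_poly hn Au hmu hbeta hmu0 hbeta0 hcG p_poly hq.
have q_fin := coefficient_finite Au hmu hbeta hmu0 hbeta0 hcG p_fin hq.
exists q; split; first by split.
have supp N : exists2 J0, (0 < J0)%N &
    (forall k j, (k <= N)%N -> (J0 <= j)%N -> forall x, p k j x = 0) /\
    (forall k j, (k <= N)%N -> (J0 <= j)%N -> forall x, q k j x = 0).
  have [J1 HJ1] : exists J, forall k j, (k < N.+1)%N -> (J <= j)%N -> forall x, p k j x = 0.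
    apply: uniform_bound => k _; have [J HJ] := finite_set_bound (p_fin k).
    by exists J => j Jj x; apply/eqP/negP => /negP h; apply: (HJ j Jj); exists x.
  have [J2 HJ2] : exists J, forall k j, (k < N.+1)%N -> (J <= j)%N -> forall x, q k j x = 0.
    by apply: uniform_bound => k _; exact: q_fin.
  exists (maxn 1 (maxn J1 J2)); first by rewrite leq_max.
  by split=> k j kN; rewrite !geq_max => /and3P[_ ? ?] x; [exact: HJ1|exact: HJ2].
have f_block N : exists J0 nu, [/\ (0 < J0)%N,
    forall k j, (k <= N)%N -> (J0 <= j)%N -> forall x, p k j x = 0,
    forall k j, (k <= N)%N -> (J0 <= j)%N -> forall x, q k j x = 0,
    mu N < nu & powO (fun t => f t - block mu beta N J0 p t) nu].
  have [J0 J0_gt0 [pJ qJ]] := supp N; have [nu nuN /bigO_at_inftyP h] := f_exp N.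
  exists J0, nu; split => //; apply: powO_near h; near=> t.
  by rewrite (expansion_block mu beta t pJ).
have hyn : \forall t \near +oo, is_derive (t : R) 1 y (- (A *m y t) + G (y t) + f t).
  by near=> t; apply: hy; near: t; apply: nbhs_pinfty_gt; exact: num_real.
pose a := mu 0%N / 2.
have a0 : 0 < a by rewrite divr_gt0.
have a_lt : a < mu 0%N by rewrite /a; lra.
have ya : powO y a.
  apply: (solution_decay hn hA hG hcG hcGm hyn hy0 (ltW a0)).
  have [J0 [nu [_ _ _ nu0 h]]] := f_block 0%N.
  apply: (powO_near (h := fun t => (f t - block mu beta 0 J0 p t) + block mu beta 0 J0 p t)).
    by near=> t; rewrite subrK.
  apply: powOD; last exact: powO_block.
  by apply: powO_weak h; rewrite ltW// (lt_trans a_lt).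
split => // [k|N].
  have [J HJ] := q_fin k; apply: (sub_finite_set _ (finite_II J)) => j [x /eqP qx].
  by rewrite /= ltnNge; apply/negP => Jj; apply: qx; exact: HJ.
have [J0 [nuf [J0_gt0 pJ qJ nufN hf0]]] := f_block N.
have muN : mu N < mu N.+1 by rewrite (exponent_lt hmu).
(* Between [mu N] and both the order of the remainder of [f] and [mu N.+1]. *)
pose nu := Num.min nuf ((mu N + mu N.+1) / 2).
have nuN : mu N < nu by rewrite lt_min nufN/=; lra.
have nuS : nu < mu N.+1 by rewrite gt_min; apply/orP; right; lra.
have nu_ge0 : 0 <= nu by rewrite ltW// (lt_trans _ nuN)// mu_gt0.
(* A degree such that the Taylor remainder, of order [M.+2 * a] with [a] half of
   [mu 0], is below the power [mu N.+1]. *)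
have [M hM] := degree_bound hmu0 (2 * mu N.+1).
have M_gt : mu N < M.+3%:R * mu 0%N.
  have := mu_gt0 hmu hmu0 N.+1; rewrite -addn2 natrD mulrDl; lra.
exists nu => //; apply/bigO_at_inftyP.
apply: (powO_near (h := fun t => y t - block mu beta N J0 q t)).
  by near=> t; rewrite (expansion_block mu beta t qJ).
apply: (@approximation_decay _ _ hn A hA G Gm cG hG hcG hcGm f y hyn hy0 M.+2
  _ (block_derive mu beta q N J0) (block mu beta N J0 p) a) => //.
- rewrite -addn1 natrD mulrDl /a; lra.
- exact: powO_block.
- near=> t; apply: is_derive_block => //; near: t; exact: nbhs_pinfty_gt.
- by apply: powO_weak hf0; rewrite ge_min lexx.
- exact: (residual hn Au hmu hbeta hmu0 hbeta0 hcG q_poly hq pJ qJ nuS M_gt J0_gt0).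
Unshelve. all: by end_near. Qed.
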